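(* For every $k\in\mathbb Z$ and every sign, and for every map $v:S_k^{\pm}\to\mathbb Z$ satisfying the conditions: $v(p,q)=0$ for all but finitely many $(p,q)\in S^\pm_k$; for every $q\in\mathbb Z$, $\sum_{p:\,(p,q)\in S_k^\pm}v(p,q)=0$; for every $p\in\mathbb Z$, $\sum_{q:\,(p,q)\in S_k^\pm}v(p,q)=0$; the formal double complex $$Z_k^{v\pm}=\sum_{(p,q)\in S_k^\pm}v(p,q)\,[Z_k^{p,q}]$$ lies in the kernel of $\chi$.
   Context: A double complex is a bigraded complex vector space $\mathcal A=\bigoplus_{p,q\in\mathbb Z}\mathcal A^{p,q}$ with $\partial$ of bidegree $(1,0)$, $\overline\partial$ of bidegree $(0,1)$, $\partial^2=\overline\partial^2=\partial\overline\partial+\overline\partial\partial=0$; bounded if $\mathcal A^{p,q}=0$ for $|p|+|q|$ large. A square is a double complex with one copy of $\mathbb C$ in each of $(p,q),(p+1,q),(p,q+1),(p+1,q+1)$ and all four maps between them isomorphisms. A dot (zigzag of length 1) is a copy of $\mathbb C$ in one bidegree. For $m\in\mathbb Z$ consider the path graph on bidegrees of total degree $m$ and $m+1$ in which $(r,s)$ with $r+s=m$ is joined to $(r+1,s)$ and $(r,s+1)$; a zigzag of length $\ge2$ has one copy of $\mathbb C$ at each of finitely many consecutive vertices of such a path, isomorphisms along the edges between them, all other maps zero. Every bounded double complex is a direct sum of squares and zigzags with unique multiplicities. $\overline{\mathcal U^{\mathrm{bounded,fin}}}$ is the abelian group generated by isomorphism classes of bounded double complexes with finitely many zigzags in their decomposition,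 with relations $[\mathcal A]+[\mathcal B]=[\mathcal A\oplus\mathcal B]$, modulo the subgroup generated by squares. $S_k^+=\{(p,q)\in\mathbb Z^2:p+q>k\}$, $S_k^-=\{(p,q)\in\mathbb Z^2:p+q<k\}$. $Z_k^{p,q}$ is the odd zigzag with support: if $p+q>k$, the bidegrees $(r,k-r)$ for $k-q\le r\le p$ and $(r,k-1-r)$ for $k-q\le r\le p-1$; if $p+q<k$, the bidegrees $(r,k-r)$ for $p\le r\le k-q$ and $(r,k+1-r)$ for $p+1\le r\le k-q$. $\chi$ is the additive map on $\overline{\mathcal U^{\mathrm{bounded,fin}}}$ sending a double complex to the array of all the following dimensions (in every degree/bidegree): Betti numbers (cohomology of the total complex with $d=\partial+\overline\partial$); Hodge numbers $\dim\ker\overline\partial/\mathrm{Im}\,\overline\partial$; Bott-Chern numbers $\dim(\ker\partial\cap\ker\overline\partial)/\mathrm{Im}\,\partial\overline\partial$; Aeppli numbers $\dim\ker\partial\overline\partial/(\mathrm{Im}\,\partial+\mathrm{Im}\,\overline\partial)$; the Varouchas numbers, i.e. dimensions of $\frac{\mathrm{Im}\partial\cap\mathrm{Im}\overline\partial}{\mathrm{Im}\partial\overline\partial}$, $\frac{\mathrm{Im}\partial\cap\ker\overline\partial}{\mathrm{Im}\partial\overline\partial}$, $\frac{\ker\partial\overline\partial}{\ker\overline\partial+\mathrm{Im}\partial}$, $\frac{\ker\partial\cap\mathrm{Im}\overline\partial}{\mathrm{Im}\partial\overline\partial}$, $\frac{\ker\partial\overline\partial}{\ker\partial+\mathrm{Im}\overline\partial}$,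 $\frac{\ker\partial\overline\partial}{\ker\overline\partial+\ker\partial}$; and the dimensions of all entries on all pages $E_r$, $r\ge1$, of the Frölicher spectral sequence (of the filtration of the total complex by the first degree $p$) and of the conjugate Frölicher spectral sequence (filtration by the second degree $q$). *)

(* Defs.v *)
From HB Require Import structures.
From mathcomp Require Import all_boot all_order all_algebra finmap zify.
From mathcomp Require Import all_classical.

Set Implicit Arguments.
Unset Strict Implicit.
Unset Printing Implicit Defensive.

Import Order.TTheory GRing.Theory Num.Theory.
Local Open Scope classical_set_scope.
Local Open Scope ring_scope.

(* The bigrading of the space is given by the family of its projections:
   each vector is the finite sum of its components. *)
Record double_complex (K : fieldType) := DoubleComplex {
  dc_space :> lmodType K;
  component : int -> int -> {linear dc_space -> dc_space};
  del : {linear dc_space -> dc_space};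
  delbar : {linear dc_space -> dc_space};
  componentK : forall p q p' q' x,
    component p q (component p' q' x) =
    if (p, q) == (p', q') then component p' q' x else 0;
  component_fin : forall x,
    finite_set [set pq : int * int | component pq.1 pq.2 x != 0];
  component_sum : forall x,
    \sum_(pq \in [set: int * int]) component pq.1 pq.2 x = x;
  del_bidegree : forall p q x,
    component p q x = x -> component (p + 1) q (del x) = del x;
  delbar_bidegree : forall p q x,
    component p q x = x -> component p (q + 1) (delbar x) = delbar x;
  del_del : forall x, del (del x) = 0;
  delbar_delbar : forall x, delbar (delbar x) = 0;
  del_delbar : forall x, del (delbar x) + delbar (del x) = 0 }.

Arguments component {K} A p q : rename.
Arguments del {K} A : rename.
Arguments delbar {K} A : rename.

Lemma fsum_support (I : choiceType) (V : zmodType) (F : I -> V) (r : seq I) :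
  uniq r -> (forall i, i \notin r -> F i = 0) ->
  \sum_(i \in [set: I]) F i = \sum_(i <- r) F i.
Proof.
move=> ur F0; rewrite (fsbigE r) //; last by move=> i _ /F0.
by apply: eq_bigl => i; rewrite in_setT.
Qed.

Section DoubleComplexes.
Variable K : fieldType.
Implicit Types A B C : double_complex K.

(* the subspace of vectors of bidegree (p,q) *)
Definition homog A (p q : int) : set A := [set x | component A p q x = x].
Arguments homog : clear implicits.

Definition bounded_dc A :=
  exists N : nat, forall p q : int, (N < `|p| + `|q|)%N ->
  homog A p q = [set 0].

Definition dc_morphism A B (f : A -> B) :=
  [/\ linear f,
      forall p q x, f (component A p q x) = component B p q (f x),
      forall x, f (del A x) = del B (f x) &
      forall x, f (delbar A x) = delbar B (f x)].

Definition isomorphic A B :=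
  exists2 f : A -> B, dc_morphism f & bijective f.

(* A is the direct sum of the family B, with injections f i *)
Definition is_direct_sum (I : choiceType) (B : I -> double_complex K) A
    (f : forall i, B i -> A) :=
  (forall i, dc_morphism (f i)) /\
  forall x : A, exists! b : forall i, B i,
    finite_set [set i | b i != 0] /\ x = \sum_(i \in [set: I]) f i (b i).

Section BinarySum.
Variables A B : double_complex K.

Definition sum_map (f : A -> A) (g : B -> B) (x : A * B) : A * B :=
  (f x.1, g x.2).

Fact sum_map_linear (f : {linear A -> A}) (g : {linear B -> B}) :
  linear (sum_map f g).
Proof. by move=> c x y; rewrite /sum_map /= !linearP. Qed.

HB.instance Definition _ (f : {linear A -> A}) (g : {linear B -> B}) :=
  GRing.isLinear.Build K (A * B)%type (A * B)%type *:%R (sum_map f g)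
    (sum_map_linear f g).

Definition sum_component p q : {linear (A * B)%type -> (A * B)%type} :=
  sum_map (component A p q) (component B p q).
Definition sum_del : {linear (A * B)%type -> (A * B)%type} :=
  sum_map (del A) (del B).
Definition sum_delbar : {linear (A * B)%type -> (A * B)%type} :=
  sum_map (delbar A) (delbar B).

Fact sum_componentK p q p' q' x : sum_component p q (sum_component p' q' x) =
  if (p, q) == (p', q') then sum_component p' q' x else 0.
Proof. by rewrite /= /sum_map /= !componentK; case: ifP. Qed.

Fact sum_component_fin x :
  finite_set [set pq : int * int | sum_component pq.1 pq.2 x != 0].
Proof.
apply: (@sub_finite_set _ _
  ([set pq : int * int | component A pq.1 pq.2 x.1 != 0] `|`
   [set pq : int * int | component B pq.1 pq.2 x.2 != 0])).
  move=> [p q] /=; rewrite /sum_map -pair_eqE /= negb_and.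
  by case/orP; [left|right].
by rewrite finite_setU; split; exact: component_fin.
Qed.

Fact sum_component_sum x :
  \sum_(pq \in [set: int * int]) sum_component pq.1 pq.2 x = x.
Proof.
pose r := enum_fset (fset_set
  ([set pq : int * int | component A pq.1 pq.2 x.1 != 0] `|`
   [set pq : int * int | component B pq.1 pq.2 x.2 != 0])).
have rP i : i \notin r ->
    component A i.1 i.2 x.1 = 0 /\ component B i.1 i.2 x.2 = 0.
  rewrite in_fset_set; last by rewrite finite_setU; split; exact: component_fin.
  by rewrite notin_setE => /not_orP[/negP + /negP]; rewrite !negbK => /eqP + /eqP.
have ur : uniq r by exact: fset_uniq.
rewrite (fsum_support ur); last first.
  by move=> i /rP[h1 h2]; rewrite /= /sum_map h1 h2.
have -> : forall s : seq (int * int), \sum_(i <- s) sum_component i.1 i.2 x =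
    (\sum_(i <- s) component A i.1 i.2 x.1,
     \sum_(i <- s) component B i.1 i.2 x.2).
  by elim=> [|i s IH]; rewrite ?big_nil // !big_cons IH.
have hA i : i \notin r -> component A i.1 i.2 x.1 = 0 by move=> /rP[].
have hB i : i \notin r -> component B i.1 i.2 x.2 = 0 by move=> /rP[].
by rewrite -(fsum_support ur hA) -(fsum_support ur hB) !component_sum; case: x {rP r ur hA hB}.
Qed.

Fact sum_del_bidegree p q x :
  sum_component p q x = x -> sum_component (p + 1) q (sum_del x) = sum_del x.
Proof.
case: x => a b [ha hb]; rewrite /= /sum_map /=.
by congr pair; exact: del_bidegree.
Qed.

Fact sum_delbar_bidegree p q x :
  sum_component p q x = x ->
  sum_component p (q + 1) (sum_delbar x) = sum_delbar x.
Proof.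
case: x => a b [ha hb]; rewrite /= /sum_map /=.
by congr pair; exact: delbar_bidegree.
Qed.

Fact sum_del_del x : sum_del (sum_del x) = 0.
Proof. by rewrite /= /sum_map /= !del_del. Qed.

Fact sum_delbar_delbar x : sum_delbar (sum_delbar x) = 0.
Proof. by rewrite /= /sum_map /= !delbar_delbar. Qed.

Fact sum_del_delbar x :
  sum_del (sum_delbar x) + sum_delbar (sum_del x) = 0.
Proof. by apply: (f_equal2 pair); exact: del_delbar. Qed.

Definition direct_sum : double_complex K :=
  DoubleComplex sum_componentK sum_component_fin sum_component_sum
    sum_del_bidegree sum_delbar_bidegree sum_del_del sum_delbar_delbar
    sum_del_delbar.

End BinarySum.

(* The support of A is S, A is one-dimensional in every bidegree of S, and
   all the arrows between two bidegrees of S are isomorphisms. *)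
Definition thin_on A (S : set (int * int)) :=
  [/\ forall p q, S (p, q) ->
        exists2 e : A, e != 0 & homog A p q = range (fun c : K => c *: e),
      forall p q, ~ S (p, q) -> homog A p q = [set 0],
      forall p q, S (p, q) -> S (p + 1, q) ->
        set_bij (homog A p q) (homog A (p + 1) q) (del A) &
      forall p q, S (p, q) -> S (p, q + 1) ->
        set_bij (homog A p q) (homog A p (q + 1)) (delbar A)].

Definition is_square A := exists p q,
  thin_on A [set (p, q); (p + 1, q); (p, q + 1); (p + 1, q + 1)].

(* The successive vertices, indexed by j in Z, of the path graph on the
   bidegrees of total degree m and m + 1:
   ..., (r, m - r), (r + 1, m - r), (r + 1, m - r - 1), ... *)
Definition path_vertex (m j : int) : int * int :=
  let r := (j %/ 2)%Z in
  if (j %% 2)%Z == 0 then (r, m - r) else (r + 1, m - r).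

Definition is_zigzag A :=
  (exists p q, thin_on A [set (p, q)]) \/
  (exists m a b, a < b /\
    thin_on A [set path_vertex m j | j in [set j | a <= j <= b]]).

(* By uniqueness of the multiplicities, the number of zigzags does not depend
   on the decomposition. *)
Definition finitely_many_zigzags A :=
  exists (I : choiceType) (B : I -> double_complex K) (f : forall i, B i -> A),
    [/\ is_direct_sum f,
        forall i, is_square (B i) \/ is_zigzag (B i) &
        finite_set [set i | is_zigzag (B i)]].

Record bdd_fin_complex := BddFinComplex {
  bfc_complex :> double_complex K;
  bfc_bounded : bounded_dc bfc_complex;
  bfc_finite : finitely_many_zigzags bfc_complex }.

(* The group U: formal expressions in the generators [X], modulo the
   congruence [ueq] generated by the axioms of abelian groups and the
   relations of U.  It is not declared as a zmodType because
   [bdd_fin_complex] is too large for the universe of choiceType. *)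
Inductive uexpr :=
  | Ugen of bdd_fin_complex
  | Uzero
  | Uopp of uexpr
  | Uadd of uexpr & uexpr.

Inductive ueq : uexpr -> uexpr -> Prop :=
  | ueq_refl x : ueq x x
  | ueq_sym x y : ueq x y -> ueq y x
  | ueq_trans x y z : ueq x y -> ueq y z -> ueq x z
  | ueq_opp x y : ueq x y -> ueq (Uopp x) (Uopp y)
  | ueq_add x x' y y' : ueq x x' -> ueq y y' -> ueq (Uadd x y) (Uadd x' y')
  | ueq_addA x y z : ueq (Uadd x (Uadd y z)) (Uadd (Uadd x y) z)
  | ueq_addC x y : ueq (Uadd x y) (Uadd y x)
  | ueq_add0 x : ueq (Uadd Uzero x) x
  | ueq_addN x : ueq (Uadd (Uopp x) x) Uzero
  | ueq_isomorphic (X Y : bdd_fin_complex) :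
      isomorphic X Y -> ueq (Ugen X) (Ugen Y)
  | ueq_direct_sum (X Y Z : bdd_fin_complex) :
      isomorphic Z (direct_sum X Y) -> ueq (Ugen Z) (Uadd (Ugen X) (Ugen Y))
  | ueq_square (X : bdd_fin_complex) : is_square X -> ueq (Ugen X) Uzero.

Record ugroup := Ugroup {
  uclass : uexpr -> Prop;
  uclassP : exists x, uclass = ueq x }.

Definition upi (x : uexpr) : ugroup := Ugroup (ex_intro _ x erefl).
Definition urepr (u : ugroup) : uexpr := projT1 (cid (uclassP u)).

(* The complex with basis the bidegrees listed in s, all lying in total
   degrees m and m + 1; the arrows send a basis vector to the one at the end
   of the arrow if that bidegree is in s, and to 0 otherwise. *)
Section PathComplex.
Variables (m : int) (s : seq (int * int)).
Hypothesis s_deg : all (fun x : int * int => (x.1 + x.2 == m) || (x.1 + x.2 == m + 1)) s.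

Local Notation V := {ffun seq_sub s -> K^o}.

Definition pcoord (f : V) (x : int * int) : K :=
  if insub x is Some t then f t else 0.

Definition path_component (p q : int) (f : V) : V :=
  [ffun t => if val t == (p, q) then f t else 0].
Definition path_del (f : V) : V :=
  [ffun t => pcoord f ((val t).1 - 1, (val t).2)].
Definition path_delbar (f : V) : V :=
  [ffun t => pcoord f ((val t).1, (val t).2 - 1)].

Fact coord_linear c (f g : V) x :
  pcoord (c *: f + g) x = c * pcoord f x + pcoord g x.
Proof. by rewrite /pcoord; case: insub => [t|]; rewrite ?ffunE ?mulr0 ?addr0. Qed.

Fact coordE (f : V) t : pcoord f (val t) = f t.
Proof. by rewrite /pcoord valK. Qed.

Fact coord_out (f : V) x : x \notin s -> pcoord f x = 0.
Proof. by move=> xs; rewrite /pcoord insubN. Qed.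

Fact path_component_linear p q : linear (path_component p q).
Proof.
move=> c f g; apply/ffunP => t; rewrite !ffunE.
by case: ifP => _ //; rewrite scaler0 addr0.
Qed.
Fact path_del_linear : linear path_del.
Proof. by move=> c f g; apply/ffunP => t; rewrite !ffunE coord_linear. Qed.
Fact path_delbar_linear : linear path_delbar.
Proof. by move=> c f g; apply/ffunP => t; rewrite !ffunE coord_linear. Qed.

HB.instance Definition _ p q := GRing.isLinear.Build K V V *:%R
  (path_component p q) (path_component_linear p q).
HB.instance Definition _ := GRing.isLinear.Build K V V *:%R
  path_del path_del_linear.
HB.instance Definition _ := GRing.isLinear.Build K V V *:%R
  path_delbar path_delbar_linear.

Fact path_componentK p q p' q' x :
  path_component p q (path_component p' q' x) =
  if (p, q) == (p', q') then path_component p' q' x else 0.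
Proof.
case: (eqVneq (p, q) (p', q')) => [[-> ->]|ne]; apply/ffunP => t; rewrite !ffunE.
  by case: eqP.
by case: eqP => // ->; rewrite (negbTE ne).
Qed.

Fact path_component_out x (pq : int * int) :
  pq \notin s -> path_component pq.1 pq.2 x = 0.
Proof.
case: pq => p q /= pqs; apply/ffunP => t; rewrite !ffunE.
by case: eqP => // e; rewrite -e (valP t) in pqs.
Qed.

Fact path_component_fin x :
  finite_set [set pq : int * int | path_component pq.1 pq.2 x != 0].
Proof.
apply: (@sub_finite_set _ _ [set` s]); last exact: finite_seq.
by move=> pq /= /eqP h; apply/negPn/negP => /path_component_out.
Qed.

Fact path_component_sum x :
  \sum_(pq \in [set: int * int]) path_component pq.1 pq.2 x = x.
Proof.
have out pq : pq \notin undup s -> path_component pq.1 pq.2 x = 0.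
  by rewrite mem_undup; exact: path_component_out.
rewrite (fsum_support (undup_uniq s) out).
apply/ffunP => t; rewrite sum_ffunE (bigD1_seq (val t)) ?undup_uniq //=; last first.
  by rewrite mem_undup (valP t).
rewrite ffunE -surjective_pairing eqxx big1 ?addr0 // => -[p q] ne.
by rewrite ffunE /= eq_sym (negbTE ne).
Qed.

Fact homog_coord p q (x : V) :
  path_component p q x = x <-> forall y, y != (p, q) -> pcoord x y = 0.
Proof.
split=> [<- y ne|h]; last first.
  by apply/ffunP => t; rewrite ffunE; case: eqP => // /eqP /h; rewrite coordE.
rewrite /pcoord; case: insubP => // t _ ty.
by rewrite ffunE ty (negbTE ne).
Qed.

Fact coord_del (f : V) y :
  pcoord (path_del f) y = if y \in s then pcoord f (y.1 - 1, y.2) else 0.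
Proof.
rewrite {1}/pcoord; case: insubP => [t ys ty|/negbTE -> //].
by rewrite ffunE ty ys.
Qed.

Fact coord_delbar (f : V) y :
  pcoord (path_delbar f) y = if y \in s then pcoord f (y.1, y.2 - 1) else 0.
Proof.
rewrite {1}/pcoord; case: insubP => [t ys ty|/negbTE -> //].
by rewrite ffunE ty ys.
Qed.

Fact path_del_bidegree p q x : path_component p q x = x ->
  path_component (p + 1) q (path_del x) = path_del x.
Proof.
move/homog_coord => h; apply/homog_coord => -[a b] ne; rewrite coord_del.
by case: ifP => // _; apply: h; apply: contra ne => /= /eqP[<- <-]; rewrite subrK.
Qed.

Fact path_delbar_bidegree p q x : path_component p q x = x ->
  path_component p (q + 1) (path_delbar x) = path_delbar x.
Proof.
move/homog_coord => h; apply/homog_coord => -[a b] ne; rewrite coord_delbar.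
by case: ifP => // _; apply: h; apply: contra ne => /= /eqP[<- <-]; rewrite subrK.
Qed.

Fact degree_out (x y : int * int) :
  x \in s -> y.1 + y.2 = x.1 + x.2 - 1 - 1 -> y \notin s.
Proof.
move=> xs e; apply/negP => ys.
by have /= := allP s_deg _ xs; have /= := allP s_deg _ ys; lia.
Qed.

Fact path_del_del x : path_del (path_del x) = 0.
Proof.
apply/ffunP => t; rewrite !ffunE coord_del; case: ifP => // _.
by apply: coord_out; apply: (degree_out (valP t)); case: (val t) => a b /=; lia.
Qed.

Fact path_delbar_delbar x : path_delbar (path_delbar x) = 0.
Proof.
apply/ffunP => t; rewrite !ffunE coord_delbar; case: ifP => // _.
by apply: coord_out; apply: (degree_out (valP t)); case: (val t) => a b /=; lia.
Qed.

Fact path_del_delbar x : path_del (path_delbar x) + path_delbar (path_del x) = 0.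
Proof.
apply/ffunP => t; rewrite !ffunE coord_del coord_delbar.
by do 2! [case: ifP => _]; rewrite ?coord_out ?addr0 //;
  apply: (degree_out (valP t)); case: (val t) => a b /=; lia.
Qed.

Definition path_complex : double_complex K :=
  DoubleComplex path_componentK path_component_fin path_component_sum
    path_del_bidegree path_delbar_bidegree path_del_del path_delbar_delbar
    path_del_delbar.

Lemma path_complex_thin : thin_on path_complex [set` s].
Proof.
have inj (x y : V) : (forall z, pcoord x z = pcoord y z) -> x = y.
  by move=> h; apply/ffunP => t; rewrite -!coordE h.
pose e p q : V := [ffun t => (val t == (p, q))%:R].
have ce p q z : pcoord (e p q) z = ((z \in s) && (z == (p, q)))%:R.
  rewrite /pcoord; case: insubP => [t zs tz|/negbTE -> //].
  by rewrite ffunE tz zs.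
have cZ c (x : V) z : pcoord (c *: x) z = c * pcoord x z.
  by rewrite -[c *: x]addr0 coord_linear [pcoord 0 z](_ : _ = 0) ?addr0 //
    /pcoord; case: insub => // t; rewrite ffunE.
have c0 z : pcoord (0 : V) z = 0.
  by rewrite /pcoord; case: insub => // t; rewrite ffunE.
split=> [p q /= pqs|p q /= pqs|p q /= h1 h2|p q /= h1 h2].
- exists (e p q).
    apply/eqP => /(congr1 (pcoord^~ (p, q))) /eqP.
    by rewrite ce c0 pqs eqxx oner_eq0.
  apply/seteqP; split=> [x /homog_coord h|_ [c _ <-]].
    exists (pcoord x (p, q)) => //; apply: inj => z; rewrite cZ ce.
    have [->|/h ->] := eqVneq z (p, q); first by rewrite pqs mulr1.
    by rewrite andbF mulr0.
  by apply/homog_coord => z /negbTE ne; rewrite cZ ce ne andbF mulr0.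
- apply/seteqP; split=> [x /homog_coord h|x -> /=]; last exact: linear0.
  apply: inj => z; rewrite c0; have [->|/h //] := eqVneq z (p, q).
  by rewrite coord_out //; apply/negP.
- split=> [x|x y /set_mem/homog_coord hx /set_mem/homog_coord hy /= exy|y].
  + exact: path_del_bidegree.
  + apply: inj => z; have [->|ne] := eqVneq z (p, q); last by rewrite hx ?hy.
    by move/(congr1 (pcoord^~ (p + 1, q))): exy; rewrite !coord_del h2 /= addrK.
  + move/homog_coord => hy; exists (pcoord y (p + 1, q) *: e p q).
      by apply/homog_coord => z /negbTE ne; rewrite cZ ce ne andbF mulr0.
    apply: inj => -[a b]; rewrite coord_del cZ ce /=.
    case: ifPn => [abs|/coord_out -> //].
    have [[-> ->]|ne] := eqVneq (a, b) (p + 1, q).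
      by rewrite addrK h1 eqxx mulr1.
    have [[ea eb]|_] := eqVneq (a - 1, b) (p, q); last by rewrite (hy (a, b)) // andbF mulr0.
    by case/eqP: ne; rewrite -ea -eb subrK.
- split=> [x|x y /set_mem/homog_coord hx /set_mem/homog_coord hy /= exy|y].
  + exact: path_delbar_bidegree.
  + apply: inj => z; have [->|ne] := eqVneq z (p, q); last by rewrite hx ?hy.
    by move/(congr1 (pcoord^~ (p, q + 1))): exy; rewrite !coord_delbar h2 /= addrK.
  + move/homog_coord => hy; exists (pcoord y (p, q + 1) *: e p q).
      by apply/homog_coord => z /negbTE ne; rewrite cZ ce ne andbF mulr0.
    apply: inj => -[a b]; rewrite coord_delbar cZ ce /=.
    case: ifPn => [abs|/coord_out -> //].
    have [[-> ->]|ne] := eqVneq (a, b) (p, q + 1).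
      by rewrite addrK h1 eqxx mulr1.
    have [[ea eb]|_] := eqVneq (a, b - 1) (p, q); last by rewrite (hy (a, b)) // andbF mulr0.
    by case/eqP: ne; rewrite -ea -eb subrK.
Qed.

Lemma path_complex_bounded : bounded_dc path_complex.
Proof.
have [_ h _ _] := path_complex_thin.
exists (\sum_(x <- s) (`|x.1| + `|x.2|))%N => p q lt; apply: h => /= pqs.
by move: lt; rewrite (big_rem _ pqs) /= ltnNge leq_addr.
Qed.

End PathComplex.

Lemma zigzag_finite A : is_zigzag A -> finitely_many_zigzags A.
Proof.
move=> zA; exists unit, (fun=> A), (fun _ x => x); split=> [|_|].
- split=> [_|x]; first by split.
  have sumE (b : unit -> A) : \sum_(i \in [set: unit]) b i = b tt.
    rewrite (_ : [set: unit] = [set tt]) ?fsbig_set1 //.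
    by apply/seteqP; split=> -[].
  exists (fun=> x); split; first by rewrite sumE; split=> //; exact: finite_finset.
  move=> b [_]; rewrite sumE => ->; apply: funext; by case.
- by right.
- exact: finite_finset.
Qed.

(* the integers r with a <= r <= b *)
Definition int_range (a b : int) : seq int :=
  if a <= b then [seq a + i%:Z | i <- iota 0 (absz (b - a)).+1] else [::].

Lemma mem_int_range a b r : (r \in int_range a b) = (a <= r <= b).
Proof.
rewrite /int_range; case: ifP => ab; last by rewrite in_nil; lia.
apply/mapP/idP => [ [i] | h ]; first by rewrite mem_iota => ? ->; lia.
by exists (absz (r - a)); rewrite ?mem_iota; lia.
Qed.

Definition Z_support (k p q : int) : seq (int * int) :=
  if k < p + q then
    [seq (r, k - r) | r <- int_range (k - q) p] ++
    [seq (r, k - 1 - r) | r <- int_range (k - q) (p - 1)]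
  else
    [seq (r, k - r) | r <- int_range p (k - q)] ++
    [seq (r, k + 1 - r) | r <- int_range (p + 1) (k - q)].

Lemma Z_support_degree k p q :
  let m := if k < p + q then k - 1 else k in
  all (fun x : int * int => (x.1 + x.2 == m) || (x.1 + x.2 == m + 1)) (Z_support k p q).
Proof.
rewrite /Z_support; case: ifP => _ /=; rewrite all_cat !all_map;
  apply/andP; split; apply/allP => r _ /=; lia.
Qed.

Definition Z_complex k p q : double_complex K :=
  path_complex (Z_support_degree k p q).

Lemma Z_complex_zigzag k p q : is_zigzag (Z_complex k p q).
Proof.
have th := path_complex_thin (Z_support_degree k p q).
have [pq|pq] := ltP k (p + q).
  right; exists (k - 1), (2 * (k - q) - 1), (2 * p - 1); split; first by lia.
  rewrite (_ : [set _ | _ in _] = [set` Z_support k p q]) //.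
  apply/seteqP; split=> [_ [j /= jr <-]|[a b] /=].
    rewrite /Z_support pq mem_cat /path_vertex; apply/orP.
    case: ifP => jm; [right|left]; apply/mapP;
      [exists (j %/ 2)%Z|exists ((j %/ 2)%Z + 1)]; rewrite ?mem_int_range;
      try lia; congr pair; lia.
  rewrite /Z_support pq mem_cat => /orP[]/mapP[r]; rewrite mem_int_range => rr [-> ->].
    exists (2 * r - 1); first by rewrite /=; lia.
    by rewrite /path_vertex; case: ifP => jm; [lia|congr pair; lia].
  exists (2 * r); first by rewrite /=; lia.
  by rewrite /path_vertex; case: ifP => jm; [congr pair; lia|lia].
have [pq'|pq'] := ltP (p + q) k; last first.
  left; exists p, q.
  rewrite (_ : [set (p, q)] = [set` Z_support k p q]) //.
  apply/seteqP; split=> [_ ->|[a b]] /=; rewrite /Z_support ltNge pq /= mem_cat.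
    apply/orP; left; apply/mapP; exists p; rewrite ?mem_int_range; first by lia.
    by congr pair; lia.
  by case/orP=> /mapP[r]; rewrite mem_int_range => ? [-> ->]; [congr pair; lia|lia].
right; exists k, (2 * p), (2 * (k - q)); split; first by lia.
rewrite (_ : [set _ | _ in _] = [set` Z_support k p q]) //.
apply/seteqP; split=> [_ [j /= jr <-]|[a b] /=].
  rewrite /Z_support ltNge pq mem_cat /path_vertex /=; apply/orP.
  case: ifP => jm; [left|right]; apply/mapP;
    [exists (j %/ 2)%Z|exists ((j %/ 2)%Z + 1)]; rewrite ?mem_int_range;
    try lia; congr pair; lia.
rewrite /Z_support ltNge pq mem_cat /= => /orP[]/mapP[r]; rewrite mem_int_range => rr [-> ->].
  exists (2 * r); first by rewrite /=; lia.
  by rewrite /path_vertex; case: ifP => jm; [congr pair; lia|lia].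
exists (2 * r - 1); first by rewrite /=; lia.
by rewrite /path_vertex; case: ifP => jm; [lia|congr pair; lia].
Qed.

Definition Z_bfc k p q : bdd_fin_complex :=
  BddFinComplex (path_complex_bounded (Z_support_degree k p q))
    (zigzag_finite (Z_complex_zigzag k p q)).

(* P and Q are subspaces of V; [dim_quot P Q] is the dimension of
   P / (P `&` Q), with default value 0 if it is infinite. *)
Definition has_dim_quot (V : lmodType K) (P Q : set V) (n : nat) :=
  exists b : 'I_n -> V, (forall i, P (b i)) /\
    forall x, P x -> exists! c : 'rV[K]_n, Q (x - \sum_(i < n) c 0 i *: b i).

Definition dim_quot (V : lmodType K) (P Q : set V) : nat :=
  xget 0%N [set n | has_dim_quot P Q n].

Definition kernel_set (U V : lmodType K) (f : U -> V) : set U := [set x | f x = 0].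

Definition sum_space (V : lmodType K) (P Q : set V) : set V :=
  [set x + y | x in P & y in Q].

Section Cohomologies.
Variable A : double_complex K.

Local Notation "'d1'" := (del A).
Local Notation "'d2'" := (delbar A).
Local Notation "'d12'" := (del A \o delbar A).

(* the dimension of P / Q in bidegree (p, q), for bigraded subspaces P, Q *)
Definition bidegree_dim (p q : int) (P Q : set A) : nat :=
  dim_quot (P `&` homog A p q) Q.

Definition total_d (x : A) : A := del A x + delbar A x.

(* the part of total degree n of the total complex *)
Definition total_degree (n : int) : set A :=
  [set x | forall p q, p + q != n -> component A p q x = 0].

Definition betti (n : int) : nat :=
  dim_quot (total_degree n `&` kernel_set total_d) (range total_d).

Definition hodge p q := bidegree_dim p q (kernel_set d2) (range d2).
Definition bott_chern p q :=
  bidegree_dim p q (kernel_set d1 `&` kernel_set d2) (range d12).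
Definition aeppli p q :=
  bidegree_dim p q (kernel_set d12) (sum_space (range d1) (range d2)).

Definition varouchas_a p q :=
  bidegree_dim p q (range d1 `&` range d2) (range d12).
Definition varouchas_b p q :=
  bidegree_dim p q (range d1 `&` kernel_set d2) (range d12).
Definition varouchas_c p q :=
  bidegree_dim p q (kernel_set d12) (sum_space (kernel_set d2) (range d1)).
Definition varouchas_d p q :=
  bidegree_dim p q (kernel_set d1 `&` range d2) (range d12).
Definition varouchas_e p q :=
  bidegree_dim p q (kernel_set d12) (sum_space (kernel_set d1) (range d2)).
Definition varouchas_f p q :=
  bidegree_dim p q (kernel_set d12) (sum_space (kernel_set d2) (kernel_set d1)).

Definition filtration1 (p : int) : set A :=
  [set x | forall r s, r < p -> component A r s x = 0].
Definition filtration2 (q : int) : set A :=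
  [set x | forall r s, s < q -> component A r s x = 0].

(* The spectral sequence of a decreasing filtration F of the total complex,
   at filtration degree p and total degree n:
     Z_r^p = {x in F^p | d x in F^(p + r)} and
     E_r^p = Z_r^p / (Z_(r-1)^(p+1) + d Z_(r-1)^(p-r+1)),  for r >= 1. *)
Definition page_cycles (F : int -> set A) (r : nat) (p n : int) : set A :=
  [set x | [/\ total_degree n x, F p x & F (p + r%:Z) (total_d x)]].

Definition page_dim (F : int -> set A) (r : nat) (p n : int) : nat :=
  dim_quot (page_cycles F r p n)
    (sum_space (page_cycles F r.-1 (p + 1) n)
       (total_d @` page_cycles F r.-1 (p - r%:Z + 1) (n - 1))).

Definition froelicher r p q := page_dim filtration1 r p (p + q).
Definition conj_froelicher r p q := page_dim filtration2 r q (p + q).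

End Cohomologies.

Inductive dc_invariant :=
  | Betti of int
  | Hodge of int & int
  | BottChern of int & int
  | Aeppli of int & int
  | VarouchasA of int & int
  | VarouchasB of int & int
  | VarouchasC of int & int
  | VarouchasD of int & int
  | VarouchasE of int & int
  | VarouchasF of int & int
  | Froelicher of nat & int & int
  | ConjFroelicher of nat & int & int.

(* the constructors [Froelicher r] and [ConjFroelicher r] stand for the
   pages E_(r+1), so that all pages from E_1 on are covered *)
Definition invariant_dim A (i : dc_invariant) : nat :=
  match i with
  | Betti n => betti A n
  | Hodge p q => hodge A p q
  | BottChern p q => bott_chern A p q
  | Aeppli p q => aeppli A p q
  | VarouchasA p q => varouchas_a A p q
  | VarouchasB p q => varouchas_b A p q
  | VarouchasC p q => varouchas_c A p q
  | VarouchasD p q => varouchas_d A p q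
  | VarouchasE p q => varouchas_e A p q
  | VarouchasF p q => varouchas_f A p q
  | Froelicher r p q => froelicher A r.+1 p q
  | ConjFroelicher r p q => conj_froelicher A r.+1 p q
  end.

Fixpoint chi_expr (x : uexpr) : dc_invariant -> int :=
  match x with
  | Ugen X => fun i => (invariant_dim X i)%:Z
  | Uzero => 0
  | Uopp y => - chi_expr y
  | Uadd y z => chi_expr y + chi_expr z
  end.

(* [chi_expr] is compatible with [ueq], so the choice of the representative
   is irrelevant. *)
Definition chi (u : ugroup) : dc_invariant -> int := chi_expr (urepr u).

Definition uscale (n : int) (x : uexpr) : uexpr :=
  match n with
  | Posz m => iter m (Uadd x) Uzero
  | Negz m => Uopp (iter m.+1 (Uadd x) Uzero)
  end.

End DoubleComplexes.

(* S_k^+ for b = true, S_k^- for b = false *)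
Definition S_region (b : bool) (k : int) : Type :=
  {x : int * int | if b then k < x.1 + x.2 else x.1 + x.2 < k}.
HB.instance Definition _ b k := Choice.on (S_region b k).

Definition Z_sum (K : fieldType) (b : bool) (k : int) (v : S_region b k -> int) :
    ugroup K :=
  upi (\big[@Uadd K/Uzero K]_(x <- fset_set [set x | v x != 0])
         uscale (v x) (Ugen (Z_bfc K k (val x).1 (val x).2))).

(* Main.v *)
From HB Require Import structures.
Require Import Defs.
From mathcomp Require Import all_boot all_order all_algebra finmap zify.
From mathcomp Require Import all_classical reals complex.

Set Implicit Arguments.
Unset Strict Implicit.
Unset Printing Implicit Defensive.

Import Order.TTheory GRing.Theory Num.Theory.
Local Open Scope classical_set_scope.
Local Open Scope complex_scope.
Local Open Scope ring_scope.

(** Every invariant is the dimension of a quotient of two subspaces, both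
    functorial in the complex. Functoriality alone makes the invariants
    additive over direct sums; as they vanish on squares, they are finite on
    complexes with finitely many zigzags and factor through the group U.

    It remains to evaluate them on Z_k^{p,q}. The bigraded invariants count
    basis vectors, since the maps are monomial in the obvious basis. For the
    pages and the Betti numbers, the first page has a single nonzero entry,
    spanned by the leading term of a globally closed class that is never a
    boundary; the conjugate pages follow by exchanging the two degrees. On
    S_k^+, and likewise on S_k^-, each invariant turns out to be of the form
    u(p) + w(q), so it is killed by the row and column conditions on v. *)

(** * Dimensions of quotients *)

Section Subspaces.
Variable K : fieldType.
Implicit Types U V : lmodType K.

(** [dim_quot] returns 0 on an infinite quotient, so additivity would be false without finiteness;
    yet a complex of the group may contain infinitely many squares and be infinite-dimensional.
    Squares are therefore treated through the inclusion of the numerator in the denominator, which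
    survives arbitrary direct sums, and only the finitely many zigzags have to supply generators.

    No differential of a spectral sequence is ever computed. A vector of any page is reduced modulo
    boundaries by removing its leading component, for which only Dolbeault cohomology has to be
    known. With the zero vector as generator the same reduction proves vanishing.

    The separation of variables comes from the geometry: an invariant at (x, y) tests a comparison
    of x with p and one of y with q, and on one side of the antidiagonal p + q = k the two cannot
    fail together, so the indicator of their conjunction is a sum. The support changes shape across
    that antidiagonal, which is why the two signs are kept apart. *)

Definition subspace V (S : set V) :=
  S 0 /\ forall (c : K) x y, S x -> S y -> S (c *: x + y).

Section Closure.
Variables (V : lmodType K) (S : set V).
Hypothesis sS : subspace S.

Lemma subspace0 : S 0. Proof. by case: sS. Qed.

Lemma subspaceD x y : S x -> S y -> S (x + y).
Proof. by case: sS => _ h Sx Sy; have := h 1 x y Sx Sy; rewrite scale1r. Qed.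

Lemma subspaceZ c x : S x -> S (c *: x).
Proof. by case: sS => S0 h Sx; have := h c x 0 Sx S0; rewrite addr0. Qed.

Lemma subspaceN x : S x -> S (- x).
Proof. by rewrite -scaleN1r; exact: subspaceZ. Qed.

Lemma subspaceB x y : S x -> S y -> S (x - y).
Proof. by move=> Sx /subspaceN; exact: subspaceD. Qed.

Lemma subspace_sum (I : Type) (r : seq I) (P : pred I) (F : I -> V) :
  (forall i, P i -> S (F i)) -> S (\sum_(i <- r | P i) F i).
Proof. by move=> h; apply: big_ind => //; [exact: subspace0|exact: subspaceD]. Qed.

Lemma subspace_fsum (I : choiceType) (F : I -> V) :
  (forall i, S (F i)) -> S (\sum_(i \in [set: I]) F i).
Proof. by move=> h; apply: subspace_sum => i _. Qed.

End Closure.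

Lemma subspaceI V (S T : set V) : subspace S -> subspace T -> subspace (S `&` T).
Proof.
move=> [S0 hS] [T0 hT]; split; first by split.
by move=> c x y [Sx Tx] [Sy Ty]; split; [exact: hS|exact: hT].
Qed.

Lemma subspace_sum_space V (S T : set V) :
  subspace S -> subspace T -> subspace (sum_space S T).
Proof.
move=> [S0 hS] [T0 hT]; split; first by exists 0 => //; exists 0; rewrite ?addr0.
move=> c _ _ [a Sa [b Tb <-]] [a' Sa' [b' Tb' <-]].
exists (c *: a + a'); first exact: hS.
by exists (c *: b + b'); [exact: hT|rewrite scalerDr addrACA].
Qed.

Lemma subspace_kernel U V (f : {linear U -> V}) : subspace (kernel_set f).
Proof.
split=> [|c x y hx hy]; first exact: linear0.
by rewrite /kernel_set /= linearP [f x]hx [f y]hy scaler0 addr0.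
Qed.

Lemma subspace_image U V (f : {linear U -> V}) (S : set U) :
  subspace S -> subspace (f @` S).
Proof.
move=> [S0 hS]; split; first by exists 0; rewrite ?linear0.
by move=> c _ _ [x Sx <-] [y Sy <-]; exists (c *: x + y); [exact: hS|rewrite linearP].
Qed.

Lemma subspaceT V : subspace [set: V]. Proof. by split. Qed.

Lemma subspace_preimage U V (f : {linear U -> V}) (S : set V) :
  subspace S -> subspace (f @^-1` S).
Proof.
move=> [S0 hS]; split; rewrite /preimage /= ?linear0 //.
by move=> c x y Sx Sy; rewrite linearP; exact: hS.
Qed.

(** This is [Q] plus the span of [l], by recursion so that inductions can peel off one generator at
    a time. *)
Fixpoint span_mod V (Q : set V) (l : seq V) (x : V) : Prop :=
  if l is v :: l' then exists c : K, span_mod Q l' (x - c *: v) else Q x.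

Lemma span_mod_subspace V (Q : set V) l : subspace Q -> subspace (span_mod Q l).
Proof.
move=> sQ; elim: l => [//|v l IH]; split; first by exists 0; rewrite scale0r subrr; case: IH.
move=> c x y [a ha] [b hb]; exists (c * a + b).
have [_ /(_ c _ _ ha hb)] := IH; congr (span_mod Q l _).
by rewrite scalerBr scalerA scalerDl opprD addrACA.
Qed.

Lemma sub_span_mod V (Q : set V) l x : Q x -> span_mod Q l x.
Proof.
by move=> Qx; elim: l => [//|v l IH]; exists 0; rewrite scale0r subr0.
Qed.

Lemma mem_span_mod V (Q : set V) l v : subspace Q -> v \in l -> span_mod Q l v.
Proof.
move=> sQ; elim: l => [//|w l IH]; rewrite inE => /orP[/eqP ->|/IH h].
  by exists 1; rewrite scale1r subrr; apply: sub_span_mod; exact: subspace0.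
by exists 0; rewrite scale0r subr0.
Qed.

(** Induction on [l], for all [P]: if [P] is not already inside the smaller span, a vector [x0] of
    [P] outside it adds exactly one dimension to the quotient of the intersection. *)
Lemma finite_dim_quot V (P Q : set V) l : subspace P -> subspace Q ->
  P `<=` span_mod Q l -> exists n, has_dim_quot P Q n.
Proof.
move=> + sQ; elim: l P => [|v l IH] P sP Pl.
  exists 0%N, (fun=> 0); split=> [[]//|x /Pl /= Qx].
  exists 0; split; first by rewrite big_ord0 subr0.
  by move=> c _; rewrite [c]thinmx0.
have [Pl'|/existsNP[x0 /not_implyP[Px0 nx0]]] := pselect (P `<=` span_mod Q l).
  exact: IH.
have sl := span_mod_subspace l sQ.
have [n [b [Pb hb]]] := IH _ (subspaceI sP sl) (fun x h => h.2).
have [c0 h0] := Pl _ Px0.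
have c0n : c0 != 0.
  by apply/eqP => c00; apply: nx0; move: h0; rewrite c00 scale0r subr0.
have x0c c : span_mod Q l (c *: x0) -> c = 0.
  move=> h; apply/eqP/negPn/negP => cn; apply: nx0.
  by rewrite -[x0]scale1r -(mulVf cn) -scalerA; exact: subspaceZ.
exists n.+1, (fun i => oapp b x0 (unlift ord0 i)); split.
  by move=> i; case: unliftP => [j _|_] //=; case: (Pb j).
move=> x Px; have [c hc] := Pl _ Px.
(* The factor [c / c0] cancels the coefficient of the generator [v], which is [c] in [x] and [c0] in
   [x0]. *)
have hx : span_mod Q l (x - (c / c0) *: x0).
  have := subspaceB sl hc (subspaceZ sl (c / c0) h0); congr (span_mod Q l _).
  by rewrite scalerBr scalerA mulfVK // opprB addrA addrNK.
have sumE (d : 'rV[K]_(1 + n)) : \sum_(i < n.+1) d 0 i *: oapp b x0 (unlift ord0 i) =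
    d 0 ord0 *: x0 + \sum_(i < n) rsubmx d 0 i *: b i.
  rewrite big_ord_recl unlift_none /=; congr (_ + _); apply: eq_bigr => i _.
  by rewrite liftK /= mxE; congr (d _ _ *: _); apply: val_inj.
have [d [hd ud]] := hb _ (conj (subspaceB sP Px (subspaceZ sP _ Px0)) hx).
exists (row_mx (c / c0)%:M d); split.
  rewrite sumE row_mxKr opprD addrA; congr (Q (_ - _ *: _ - _)): hd.
  have -> : ord0 = lshift n ord0 :> 'I_(1 + n) by apply: val_inj.
  by rewrite row_mxEl mxE eqxx.
move=> d' hd'.
have {}hd' : Q (x - d' 0 ord0 *: x0 - \sum_(i < n) rsubmx (d' : 'rV_(1 + n)) 0 i *: b i).
  by move: hd'; rewrite (sumE d') opprD addrA.
have e0 : d' 0 ord0 = c / c0.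
  apply/eqP; rewrite -subr_eq0; apply/eqP/x0c.
  have h2 : span_mod Q l (x - d' 0 ord0 *: x0).
    rewrite -[X in span_mod _ _ X](subrK (\sum_(i < n) rsubmx (d' : 'rV_(1 + n)) 0 i *: b i)).
    apply: subspaceD => //; first exact: sub_span_mod.
    by apply: subspace_sum => // i _; apply: subspaceZ => //; case: (Pb i).
  have := subspaceB sl hx h2; congr (span_mod Q l _).
  by rewrite scalerBl opprB addrC addrA addrNK.
rewrite e0 in hd'; rewrite (ud _ hd'); apply/rowP => i; rewrite mxE.
case: splitP => j ij; rewrite mxE.
  by rewrite ord1 eqxx -e0; congr (d' _ _); apply: val_inj; rewrite /= ij ord1.
by congr (d' _ _); apply: val_inj; rewrite /= ij.
Qed.

(** Expressing each basis in the other modulo [Q] gives matrices [M] and [N]. Row i of [M *m N] and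
    row i of the identity are both coordinates of [b i], so uniqueness gives [M *m N = 1], whence
    [n <= m]. *)
Lemma has_dim_quot_le V (P Q : set V) n m : subspace P -> subspace Q ->
  has_dim_quot P Q n -> has_dim_quot P Q m -> (n <= m)%N.
Proof.
move=> sP sQ [b [Pb hb]] [b' [Pb' hb']].
have [M hM] : exists M : 'M[K]_(n, m), forall i, Q (b i - \sum_j M i j *: b' j).
  have [M hM] := choice (fun i => hb' _ (Pb i)).
  exists (\matrix_i M i) => i; have [/= h _] := hM i.
  by move: h; under eq_bigr do rewrite -[M i](rowK M) mxE.
have [N hN] : exists N : 'M[K]_(m, n), forall i, Q (b' i - \sum_j N i j *: b j).
  have [N hN] := choice (fun i => hb _ (Pb' i)).
  exists (\matrix_i N i) => i; have [/= h _] := hN i.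
  by move: h; under eq_bigr do rewrite -[N i](rowK N) mxE.
apply: (@mulmx1_min _ _ _ M N); apply/row_matrixP => i.
have [c [_ uc]] := hb _ (Pb i).
rewrite -[RHS](uc (row i 1%:M)); last first.
  rewrite (bigD1 i) //= big1 ?addr0 => [|j ji].
    by rewrite !mxE eqxx scale1r subrr; exact: subspace0.
  by rewrite !mxE eq_sym (negbTE ji) scale0r.
apply/esym/uc; have -> : \sum_(j < n) row i (M *m N) 0 j *: b j =
    \sum_j M i j *: (\sum_k N j k *: b k).
  under [RHS]eq_bigr do rewrite scaler_sumr.
  rewrite exchange_big; apply: eq_bigr => j _.
  rewrite !mxE scaler_suml; apply: eq_bigr => k _; by rewrite scalerA.
have h : Q (\sum_j M i j *: (b' j - \sum_k N j k *: b k)).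
  by apply: subspace_sum => // j _; exact: subspaceZ.
have := subspaceD sQ (hM i) h; congr Q.
under [X in _ + X]eq_bigr do rewrite scalerBr.
by rewrite sumrB addrA addrNK.
Qed.

Lemma dim_quotE V (P Q : set V) n : subspace P -> subspace Q ->
  has_dim_quot P Q n -> dim_quot P Q = n.
Proof.
move=> sP sQ hn; rewrite /dim_quot; apply: xget_unique => //= m hm.
by apply/eqP; rewrite eqn_leq !(has_dim_quot_le sP sQ).
Qed.

Lemma dim_quot_sub V (P Q : set V) : subspace P -> subspace Q ->
  P `<=` Q -> dim_quot P Q = 0%N.
Proof.
move=> sP sQ PQ; apply: dim_quotE => //; exists (fun=> 0); split=> [[]//|x /PQ Qx].
exists 0; split; first by rewrite big_ord0 subr0.
by move=> c _; rewrite [c]thinmx0.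
Qed.

Lemma dim_quot_line V (P Q : set V) e : subspace P -> subspace Q -> P e -> ~ Q e ->
  (forall x, P x -> exists c : K, Q (x - c *: e)) -> dim_quot P Q = 1%N.
Proof.
move=> sP sQ Pe nQe h; apply: dim_quotE => //; exists (fun=> e); split=> // x /h [c hc].
exists c%:M; split; first by rewrite big_ord1 mxE eqxx.
move=> d; rewrite big_ord1 => hd; apply/rowP => i; rewrite mxE ord1 eqxx /=.
apply/eqP/negPn/negP => ne; apply: nQe.
have := subspaceZ sQ (d 0 0 - c)^-1 (subspaceB sQ hc hd); congr Q.
rewrite opprB [X in _ *: X]addrC addrA addrNK -scalerBl scalerA mulVf ?scale1r //.
by rewrite subr_eq0 eq_sym.
Qed.

End Subspaces.

(** * Functoriality of the invariants *)

Arguments homog {K} A p q _ : rename.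

Section Invariants.
Variable K : fieldType.
Implicit Types A B : double_complex K.

Fact total_d_linear A : linear (@total_d K A).
Proof. by move=> c x y; rewrite /total_d !linearP scalerDr addrACA. Qed.
HB.instance Definition _ A :=
  GRing.isLinear.Build K A A *:%R (@total_d K A) (@total_d_linear A).

Lemma total_dE A (x : A) : total_d x = del A x + delbar A x.
Proof. by []. Qed.

Lemma total_d_total_d A (x : A) : total_d (total_d x) = 0.
Proof.
rewrite {2}/total_d linearD /= /total_d del_del delbar_delbar add0r addr0.
by rewrite addrC del_delbar.
Qed.

(** Numerators and denominators are indexed by the invariant, so that functoriality, additivity and
    invariance are each stated once. *)
Definition invariant_num A (i : dc_invariant) : set A :=
  let k1 := kernel_set (del A) in let k2 := kernel_set (delbar A) in
  let k12 := kernel_set (del A \o delbar A) in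
  match i with
  | Betti n => total_degree n `&` kernel_set (@total_d _ A)
  | Hodge p q => k2 `&` homog A p q
  | BottChern p q => k1 `&` k2 `&` homog A p q
  | Aeppli p q => k12 `&` homog A p q
  | VarouchasA p q => range (del A) `&` range (delbar A) `&` homog A p q
  | VarouchasB p q => range (del A) `&` k2 `&` homog A p q
  | VarouchasC p q => k12 `&` homog A p q
  | VarouchasD p q => k1 `&` range (delbar A) `&` homog A p q
  | VarouchasE p q => k12 `&` homog A p q
  | VarouchasF p q => k12 `&` homog A p q
  | Froelicher r p q => page_cycles (@filtration1 _ A) r.+1 p (p + q)
  | ConjFroelicher r p q => page_cycles (@filtration2 _ A) r.+1 q (p + q)
  end.

Arguments invariant_num : clear implicits.

Definition page_boundaries A (F : int -> set A) (r : nat) (p n : int) : set A :=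
  sum_space (page_cycles F r.-1 (p + 1) n)
    (@total_d _ A @` page_cycles F r.-1 (p - r%:Z + 1) (n - 1)).

Definition invariant_den A (i : dc_invariant) : set A :=
  let k1 := kernel_set (del A) in let k2 := kernel_set (delbar A) in
  let i12 := range (del A \o delbar A) in
  match i with
  | Betti n => range (@total_d _ A)
  | Hodge p q => range (delbar A)
  | BottChern p q => i12
  | Aeppli p q => sum_space (range (del A)) (range (delbar A))
  | VarouchasA p q => i12
  | VarouchasB p q => i12
  | VarouchasC p q => sum_space k2 (range (del A))
  | VarouchasD p q => i12
  | VarouchasE p q => sum_space k1 (range (delbar A))
  | VarouchasF p q => sum_space k2 k1
  | Froelicher r p q => page_boundaries (@filtration1 _ A) r.+1 p (p + q)
  | ConjFroelicher r p q => page_boundaries (@filtration2 _ A) r.+1 q (p + q)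
  end.

Arguments invariant_den : clear implicits.

Lemma invariant_dimE A i :
  invariant_dim A i = dim_quot (invariant_num A i) (invariant_den A i).
Proof. by case: i. Qed.

Lemma subspace_homog A p q : subspace (homog A p q).
Proof.
split=> [|c x y hx hy]; first exact: linear0.
by rewrite /homog /= linearP [component A p q x]hx [component A p q y]hy.
Qed.

Lemma subspace_total_degree A n : subspace (@total_degree K A n).
Proof.
split=> [p q _|c x y hx hy p q ne]; first exact: linear0.
by rewrite linearP hx // hy // scaler0 addr0.
Qed.

Lemma subspace_filtration1 A p : subspace (@filtration1 K A p).
Proof.
split=> [r s _|c x y hx hy r s lt]; first exact: linear0.
by rewrite linearP hx // hy // scaler0 addr0.
Qed.

Lemma subspace_filtration2 A p : subspace (@filtration2 K A p).
Proof.
split=> [r s _|c x y hx hy r s lt]; first exact: linear0.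
by rewrite linearP hx // hy // scaler0 addr0.
Qed.

Section Pages.
Variables (A : double_complex K) (F : int -> set A).
Hypothesis sF : forall p, subspace (F p).

Lemma subspace_page_cycles r p n : subspace (page_cycles F r p n).
Proof.
have -> : page_cycles F r p n =
    total_degree n `&` F p `&` (@total_d _ A @^-1` F (p + r%:Z)).
  by apply/seteqP; split=> x; [case|case=> - []].
apply: subspaceI; first by apply: subspaceI => //; exact: subspace_total_degree.
exact: (subspace_preimage (@total_d _ A)).
Qed.

Lemma subspace_page_boundaries r p n : subspace (page_boundaries F r p n).
Proof.
apply: subspace_sum_space; first exact: subspace_page_cycles.
by apply: (subspace_image (@total_d _ A)); exact: subspace_page_cycles.
Qed.

End Pages.

Lemma subspace_range (U V : lmodType K) (f : {linear U -> V}) :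
  subspace (range f).
Proof. by apply: subspace_image; exact: subspaceT. Qed.

Lemma subspace_num A i : subspace (invariant_num A i).
Proof.
have s1 := subspace_kernel (del A); have s2 := subspace_kernel (delbar A).
have r1 := subspace_range (del A); have r2 := subspace_range (delbar A).
have s12 := subspace_kernel (del A \o delbar A).
have sd := subspace_kernel (@total_d _ A).
case: i => [n|p q|p q|p q|p q|p q|p q|p q|p q|p q|r p q|r p q] /=;
  try by [do 2?[apply: subspaceI => //]; exact: subspace_homog].
- by apply: subspaceI => //; exact: subspace_total_degree.
- by apply: subspace_page_cycles; exact: subspace_filtration1.
- by apply: subspace_page_cycles; exact: subspace_filtration2.
Qed.

Lemma subspace_den A i : subspace (invariant_den A i).
Proof.
have s1 := subspace_kernel (del A); have s2 := subspace_kernel (delbar A).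
have r1 := subspace_range (del A); have r2 := subspace_range (delbar A).
have r12 := subspace_range (del A \o delbar A).
have rd := subspace_range (@total_d _ A).
case: i => [n|p q|p q|p q|p q|p q|p q|p q|p q|p q|r p q|r p q] //=;
  try exact: subspace_sum_space.
- by apply: subspace_page_boundaries; exact: subspace_filtration1.
- by apply: subspace_page_boundaries; exact: subspace_filtration2.
Qed.

Section Functoriality.
Variables (A B : double_complex K) (f : A -> B).
Hypothesis fM : dc_morphism f.

(** [dc_morphism] carries linearity as a proposition; replacing [f] by a bundled map gives access to
    the algebra of linear maps. *)
Lemma morphism_linear : {g : {linear A -> B} | f = g :> (A -> B)}.
Proof.
have [lf _ _ _] := fM.
by exists (HB.pack_for {linear A -> B} f (GRing.isLinear.Build K A B *:%R f lf)).
Qed.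

Lemma morphism0 : f 0 = 0.
Proof. by have [g ->] := morphism_linear; exact: linear0. Qed.

Lemma morphism_total_d x : f (total_d x) = total_d (f x).
Proof.
have [_ _ f1 f2] := fM; rewrite !total_dE -f1 -f2.
by have [g ->] := morphism_linear; exact: linearD.
Qed.

Lemma morphism_homog p q x : homog A p q x -> homog B p q (f x).
Proof. by have [_ fc _ _] := fM; rewrite /homog /= -fc => ->. Qed.

Lemma morphism_total_degree n x : total_degree n x -> total_degree n (f x).
Proof.
by have [_ fc _ _] := fM; move=> h p q /h; rewrite -fc => ->; exact: morphism0.
Qed.

Lemma morphism_filtration1 p x : filtration1 p x -> filtration1 p (f x).
Proof.
by have [_ fc _ _] := fM; move=> h r s /h; rewrite -fc => ->; exact: morphism0.
Qed.

Lemma morphism_filtration2 p x : filtration2 p x -> filtration2 p (f x).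
Proof.
by have [_ fc _ _] := fM; move=> h r s /h; rewrite -fc => ->; exact: morphism0.
Qed.

Lemma morphism_kernel (u : A -> A) (w : B -> B) x :
  (forall x, f (u x) = w (f x)) -> kernel_set u x -> kernel_set w (f x).
Proof. by move=> fu; rewrite /kernel_set /= -fu => ->; exact: morphism0. Qed.

Lemma morphism_range (u : A -> A) (w : B -> B) x :
  (forall x, f (u x) = w (f x)) -> range u x -> range w (f x).
Proof. by move=> fu [y _ <-]; exists (f y); rewrite ?fu. Qed.

Lemma morphism_sum_space (S T : set A) (S' T' : set B) x :
  (forall x, S x -> S' (f x)) -> (forall x, T x -> T' (f x)) ->
  sum_space S T x -> sum_space S' T' (f x).
Proof.
move=> hS hT [a /hS Sa [b /hT Tb <-]]; exists (f a) => //; exists (f b) => //.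
by have [g ->] := morphism_linear; rewrite linearD.
Qed.

Section Pages.
Variables (F : int -> set A) (G : int -> set B).
Hypothesis fF : forall p x, F p x -> G p (f x).

Lemma morphism_page_cycles r p n x :
  page_cycles F r p n x -> page_cycles G r p n (f x).
Proof.
move=> [h1 h2 h3]; split; first exact: morphism_total_degree.
  exact: fF.
by rewrite -morphism_total_d; exact: fF.
Qed.

Lemma morphism_page_boundaries r p n x :
  page_boundaries F r p n x -> page_boundaries G r p n (f x).
Proof.
apply: morphism_sum_space; first exact: morphism_page_cycles.
move=> _ [y hy <-]; exists (f y); last by rewrite morphism_total_d.
exact: morphism_page_cycles.
Qed.

End Pages.

Lemma morphism_num i x : invariant_num A i x -> invariant_num B i (f x).
Proof.
have [_ _ f1 f2] := fM.
have f12 y : f ((del A \o delbar A) y) = (del B \o delbar B) (f y).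
  by rewrite /= f1 f2.
have fd := morphism_total_d.
case: i => [n|p q|p q|p q|p q|p q|p q|p q|p q|p q|r p q|r p q] /=.
- by move=> [/morphism_total_degree ? /(morphism_kernel fd)].
- by move=> [/(morphism_kernel f2) ? /morphism_homog].
- by move=> [[/(morphism_kernel f1) ? /(morphism_kernel f2) ?] /morphism_homog].
- by move=> [/(morphism_kernel f12) ? /morphism_homog].
- by move=> [[/(morphism_range f1) ? /(morphism_range f2) ?] /morphism_homog].
- by move=> [[/(morphism_range f1) ? /(morphism_kernel f2) ?] /morphism_homog].
- by move=> [/(morphism_kernel f12) ? /morphism_homog].
- by move=> [[/(morphism_kernel f1) ? /(morphism_range f2) ?] /morphism_homog].
- by move=> [/(morphism_kernel f12) ? /morphism_homog].
- by move=> [/(morphism_kernel f12) ? /morphism_homog].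
- exact/morphism_page_cycles/morphism_filtration1.
- exact/morphism_page_cycles/morphism_filtration2.
Qed.

Lemma morphism_den i x : invariant_den A i x -> invariant_den B i (f x).
Proof.
have [_ _ f1 f2] := fM.
have f12 y : f ((del A \o delbar A) y) = (del B \o delbar B) (f y).
  by rewrite /= f1 f2.
have fd := morphism_total_d.
have k1 y := @morphism_kernel _ _ y f1; have k2 y := @morphism_kernel _ _ y f2.
have r1 y := @morphism_range _ _ y f1; have r2 y := @morphism_range _ _ y f2.
case: i => [n|p q|p q|p q|p q|p q|p q|p q|p q|p q|r p q|r p q] /=;
  try exact: morphism_range; try exact: morphism_sum_space.
- exact/morphism_page_boundaries/morphism_filtration1.
- exact/morphism_page_boundaries/morphism_filtration2.
Qed.

End Functoriality.

End Invariants.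

Arguments invariant_num {K} A i _ : rename.
Arguments invariant_den {K} A i _ : rename.

(** * Leading terms and the spectral sequence *)

Section Components.
Variables (K : fieldType) (A : double_complex K).
Implicit Types x y : A.

Lemma component_homog p q x : homog A p q (component A p q x).
Proof. by rewrite /homog /= componentK eqxx. Qed.

Lemma homog_component p q a b x : homog A a b x ->
  component A p q x = if (p, q) == (a, b) then x else 0.
Proof. by move=> hx; rewrite -{1}[x]hx componentK [component A a b x]hx. Qed.

Lemma component_inj x y :
  (forall p q, component A p q x = component A p q y) -> x = y.
Proof.
move=> h; rewrite -(component_sum x) -(component_sum y).
by apply: eq_fsbigr => -[p q] _.
Qed.

Lemma component_list x : exists r : seq (int * int),
  uniq r /\ x = \sum_(i <- r) component A i.1 i.2 x.
Proof.
exists (fset_set [set pq : int * int | component A pq.1 pq.2 x != 0]); split.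
  exact: fset_uniq.
rewrite -[LHS](component_sum x); apply: fsum_support; first exact: fset_uniq.
move=> pq; rewrite in_fset_set; last exact: component_fin.
by rewrite notin_setE => /negP; rewrite negbK => /eqP.
Qed.

Lemma component_shift (f : {linear A -> A}) (u v p q : int) x :
  (forall p q y, component A p q y = y ->
     component A (p + u) (q + v) (f y) = f y) ->
  component A (p + u) (q + v) (f x) = f (component A p q x).
Proof.
move=> hf; have [r [ur {1 2}->]] := component_list x.
rewrite !linear_sum; apply: eq_bigr => -[a b] _ /=.
rewrite (homog_component _ _ (hf _ _ _ (component_homog a b x))).
rewrite (homog_component _ _ (component_homog a b x)) !xpair_eqE.
by rewrite !(inj_eq (addIr _)); case: ifP => // _; rewrite linear0.
Qed.

Lemma component_del p q x :
  component A (p + 1) q (del A x) = del A (component A p q x).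
Proof.
rewrite -[q in LHS]addr0; apply: component_shift => {}p {}q y hy.
by rewrite addr0; exact: del_bidegree.
Qed.

Lemma component_delbar p q x :
  component A p (q + 1) (delbar A x) = delbar A (component A p q x).
Proof.
rewrite -[p in LHS]addr0; apply: component_shift => {}p {}q y hy.
by rewrite addr0; exact: delbar_bidegree.
Qed.

Lemma component_total_d p q x : component A p q (total_d x) =
  del A (component A (p - 1) q x) + delbar A (component A p (q - 1) x).
Proof.
by rewrite -component_del -component_delbar !subrK linearD.
Qed.

Lemma total_degree_total_d n x :
  total_degree n x -> total_degree (n + 1) (total_d x).
Proof.
move=> h p q ne; rewrite component_total_d !h ?linear0 ?addr0 //;
  by apply: contra ne => /eqP <-; lia.
Qed.

Lemma total_degree_homog p q x : homog A p q x -> total_degree (p + q) x.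
Proof.
move=> h a b ne; rewrite (homog_component _ _ h); case: eqP => // -[ea eb].
by rewrite ea eb eqxx in ne.
Qed.

Lemma filtration1_homog p q x : homog A p q x -> filtration1 p x.
Proof.
move=> h a b lt; rewrite (homog_component _ _ h); case: eqP => // -[ea eb].
by rewrite ea ltxx in lt.
Qed.

Lemma filtration1_le p p' x : p' <= p -> filtration1 p x -> filtration1 p' x.
Proof. by move=> le h r s lt; apply: h; exact: lt_le_trans lt le. Qed.

Lemma filtration1_total_d p x : filtration1 p x -> filtration1 p (total_d x).
Proof.
move=> h r s lt; rewrite component_total_d !h ?linear0 ?addr0 //.
by apply: le_lt_trans lt; rewrite gerBl.
Qed.

Lemma total_dD x y : total_d (x + y) = total_d x + total_d y.
Proof. exact: linearD. Qed.

Lemma total_d_closed x : total_d x = 0 -> forall y c, total_d (y - c *: x) = total_d y.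
Proof. by move=> h y c; rewrite linearB linearZ /= h scaler0 subr0. Qed.

(* The Dolbeault cohomology in bidegree (p, q) is spanned by the leading
   component of a d-closed vector e, or vanishes. *)
Definition hodge_spanned (e : A) (p q : int) :=
  forall x, homog A p q x -> delbar A x = 0 -> exists y (c : K),
    [/\ homog A p (q - 1) y, x = delbar A y + c *: component A p q e &
        c = 0 \/ filtration1 p e].

Section Leading.
Variable e : A.
Hypothesis e_closed : total_d e = 0.

(** Since [total_d x] has no component in column p, the component of [x] in bidegree (p, q) is
    [delbar]-closed. The hypothesis writes it as [delbar A y] plus a multiple of the component of
    [e]; subtracting [total_d y] and that multiple of [e] pushes [x] into the next filtration step
    without changing its differential. *)
Lemma leading_term p q x : hodge_spanned e p q -> total_degree (p + q) e ->
  total_degree (p + q) x -> filtration1 p x -> filtration1 (p + 1) (total_d x) ->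
  exists y (c : K), [/\ homog A p (q - 1) y, c = 0 \/ filtration1 p e,
    filtration1 (p + 1) (x - total_d y - c *: e),
    total_degree (p + q) (x - total_d y - c *: e) &
    total_d (x - total_d y - c *: e) = total_d x].
Proof.
move=> H ne nx Fx Fdx.
have dx0 : delbar A (component A p q x) = 0.
  have := Fdx p (q + 1); rewrite ltrDl ltr01 => /(_ isT).
  rewrite component_total_d addrK (Fx (p - 1)) ?linear0 ?add0r //.
  by rewrite ltrBlDr ltrDl.
have [y [c [hy xE ce]]] := H _ (component_homog p q x) dx0.
exists y, c.
have nz : total_degree (p + q) (x - total_d y - c *: e).
  have sn := @subspace_total_degree _ A (p + q).
  have ndy : total_degree (p + q) (total_d y).
    rewrite [p + q](_ : _ = p + (q - 1) + 1); last by lia.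
    exact: (total_degree_total_d (total_degree_homog hy)).
  exact: (subspaceB sn (subspaceB sn nx ndy) (subspaceZ sn c ne)).
split=> //; last by rewrite total_d_closed // linearB /= total_d_total_d subr0.
(* Left of column p every term vanishes. In column p the total degree leaves only the bidegree (p,
   q), where [y] and [c] were chosen to cancel. *)
move=> r s; rewrite ltzD1 le_eqVlt => /orP[/eqP ->|lt]; last first.
  rewrite !linearB linearZ /= (Fx r) // (filtration1_total_d (filtration1_homog hy)) //.
  by case: ce => [->|/(_ r s lt) ->]; rewrite ?scale0r ?scaler0 !subr0.
have [ns|ns] := eqVneq (p + s) (p + q); last exact: nz.
have -> : s = q by exact: addrI ns.
rewrite !linearB linearZ /= component_total_d xE.
rewrite [component A (p - 1) q y](homog_component _ _ hy).
rewrite xpair_eqE [p - 1 == p](_ : _ = false) ?linear0 ?add0r; last by lia.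
by rewrite hy -addrA -opprD subrr.
Qed.

(** One removal of the leading term suffices on every page: the remainder lies one filtration step
    higher with the same differential, and [y], being homogeneous of column p, is an admissible
    source of a boundary whatever the page. *)
Lemma page_spanned r p q x : hodge_spanned e p q -> total_degree (p + q) e ->
  page_cycles (@filtration1 K A) r.+1 p (p + q) x ->
  exists c : K, (c = 0 \/ filtration1 p e) /\
    page_boundaries (@filtration1 K A) r.+1 p (p + q) (x - c *: e).
Proof.
move=> H ne [nx Fx Fdx].
have [|y [c [hy ce Fz nz dz]]] := leading_term H ne nx Fx.
  by apply: filtration1_le Fdx; lia.
exists c; split=> //; exists (x - total_d y - c *: e).
  split=> //; rewrite dz /=; apply: filtration1_le Fdx; lia.
exists (total_d y); last by rewrite addrAC subrK.
exists y => //; split; first by rewrite -addrA; exact: total_degree_homog.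
  by apply: filtration1_le (filtration1_homog hy); lia.
by apply: filtration1_le (filtration1_total_d (filtration1_homog hy)) => /=; lia.
Qed.

(** Leading terms are removed column by column; boundedness makes the filtration finite, so the
    process ends at zero. *)
Lemma betti_spanned n x : bounded_dc A -> (forall p, hodge_spanned e p (n - p)) ->
  total_degree n e -> total_degree n x -> total_d x = 0 ->
  exists c : K, range (@total_d K A) (x - c *: e).
Proof.
move=> [N bN] H ne nx dx.
have bN' p q y : (N < `|p| + `|q|)%N -> component A p q y = 0.
  by move/bN => h; have := component_homog p q y; rewrite h.
suff main (m : nat) y : total_degree n y -> total_d y = 0 ->
    filtration1 (N%:Z + 1 - m%:Z) y -> exists c : K, range (@total_d K A) (y - c *: e).
  (* Columns beyond N in absolute value are zero: every vector lies in step -N - 1, and step N + 1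
     is zero, hence 2N + 2 removals. *)
  apply: (main (N + N).+2) => // r s lt; apply: bN'; lia.
elim: m y => [|m IH] y ny dy Fy.
  exists 0; exists 0 => //; rewrite linear0 scale0r subr0.
  apply/esym/component_inj => r s; rewrite linear0.
  have [lt|ge] := ltP r (N%:Z + 1); first by apply: Fy; lia.
  by apply: bN'; lia.
pose p := N%:Z + 1 - m.+1%:Z; have pn : n = p + (n - p) by rewrite addrC subrK.
have [||||z [c [hz ce Fz nz dz]]] := @leading_term p (n - p) y (H p).
- by rewrite -pn.
- by rewrite -pn.
- exact: Fy.
- by rewrite dy => r s _; exact: linear0.
have [||c' [w _ wE]] := IH _ _ (etrans dz dy); first by rewrite pn.
  by apply: filtration1_le Fz; rewrite /p; lia.
exists (c + c'); exists (w + z) => //.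
rewrite total_dD wE; move: (total_d z) => t.
by rewrite scalerDl opprD addrA !(addrAC _ _ t) addrK.
Qed.

End Leading.

End Components.

(** * Squares *)

Section Swap.
Variables (K : fieldType) (A : double_complex K).

Fact swap_componentK p q p' q' (x : A) :
  component A q p (component A q' p' x) =
  if (p, q) == (p', q') then component A q' p' x else 0.
Proof. by rewrite componentK !xpair_eqE andbC. Qed.

Fact swap_component_sum (x : A) :
  \sum_(pq \in [set: int * int]) component A pq.2 pq.1 x = x.
Proof.
pose sw (pq : int * int) := (pq.2, pq.1); have swK : cancel sw sw by case.
pose s := fset_set [set pq : int * int | component A pq.1 pq.2 x != 0].
have sP i : i \notin enum_fset s -> component A i.1 i.2 x = 0.
  rewrite in_fset_set; last exact: component_fin.
  by rewrite notin_setE => /negP; rewrite negbK => /eqP.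
rewrite (@fsum_support _ _ _ (map sw (enum_fset s))).
- by rewrite big_map -(fsum_support (fset_uniq s) sP) component_sum.
- by rewrite (map_inj_uniq (can_inj swK)) fset_uniq.
- move=> [p q] ni; apply: (sP (q, p)); apply: contra ni => h.
  by apply/mapP; exists (q, p).
Qed.

Fact swap_component_fin (x : A) :
  finite_set [set pq : int * int | component A pq.2 pq.1 x != 0].
Proof.
apply: (@sub_finite_set _ _ ((fun pq : int * int => (pq.2, pq.1)) @`
    [set pq : int * int | component A pq.1 pq.2 x != 0])).
  by move=> [p q] h; exists (q, p).
by apply: finite_image; exact: component_fin.
Qed.

Fact swap_del_delbar (x : A) : delbar A (del A x) + del A (delbar A x) = 0.
Proof. by rewrite addrC del_delbar. Qed.

(* The complex conjugate bigrading, which exchanges the two filtrations. *)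
Definition swap_dc : double_complex K :=
  @DoubleComplex K A (fun p q => component A q p) (delbar A) (del A)
    swap_componentK swap_component_fin swap_component_sum
    (fun p q x => @delbar_bidegree K A q p x)
    (fun p q x => @del_bidegree K A q p x)
    (@delbar_delbar K A) (@del_del K A) swap_del_delbar.

Lemma swap_total_d : @total_d K swap_dc = @total_d K A.
Proof. by apply: funext => x; rewrite /total_d /= addrC. Qed.

Lemma swap_total_degree n : @total_degree K swap_dc n = @total_degree K A n.
Proof.
by apply/seteqP; split=> x h p q ne; apply: (h q p); rewrite addrC.
Qed.

Lemma swap_filtration1 : @filtration1 K swap_dc = @filtration2 K A.
Proof. by apply: funext => p; apply/seteqP; split=> x h r s; exact: h. Qed.

Lemma swap_page_cycles F r p n :
  @page_cycles K swap_dc F r p n = @page_cycles K A F r p n.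
Proof.
by rewrite /page_cycles swap_total_degree swap_total_d.
Qed.

Lemma conj_num r p q :
  invariant_num A (ConjFroelicher r p q) = invariant_num swap_dc (Froelicher r q p).
Proof. by rewrite /= swap_page_cycles swap_filtration1 (addrC q p). Qed.

Lemma conj_den r p q :
  invariant_den A (ConjFroelicher r p q) = invariant_den swap_dc (Froelicher r q p).
Proof.
by rewrite /= /page_boundaries !swap_page_cycles swap_filtration1 swap_total_d (addrC q p).
Qed.

Lemma swap_thin S : thin_on A S -> thin_on swap_dc [set pq | S (pq.2, pq.1)].
Proof.
case=> h1 h2 h3 h4; split=> p q; [exact: (h1 q p)|exact: (h2 q p)|..].
  exact: (h4 q p).
exact: (h3 q p).
Qed.

End Swap.

Section Squares.
Variables (K : fieldType).
Implicit Type A : double_complex K.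

Lemma swap_square A : is_square A -> is_square (swap_dc A).
Proof.
move=> [a [b /swap_thin th]]; exists b, a.
rewrite [X in thin_on _ X](_ : _ = [set pq | [set (a, b); (a + 1, b); (a, b + 1);
  (a + 1, b + 1)] (pq.2, pq.1)]) //.
by apply/seteqP; split=> -[p q] /=; intuition congruence.
Qed.

Lemma hodge_spanned0 A p q :
  (forall x, homog A p q x -> delbar A x = 0 ->
     exists2 y, homog A p (q - 1) y & x = delbar A y) -> hodge_spanned (0 : A) p q.
Proof.
move=> h x hx dx; have [y hy ->] := h x hx dx.
by exists y, 0; split=> //; [rewrite scale0r addr0|left].
Qed.

Section Square.
Variables (A : double_complex K) (a b : int).
Hypothesis th :
  thin_on A [set (a, b); (a + 1, b); (a, b + 1); (a + 1, b + 1)].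

Lemma square_degree p q x : homog A p q x -> x = 0 \/
  ((p = a \/ p = a + 1) /\ (q = b \/ q = b + 1)).
Proof.
case: th => _ h0 _ _; have [inS|nS] := pselect
    ([set (a, b); (a + 1, b); (a, b + 1); (a + 1, b + 1)] (p, q)).
  by move=> _; right; case: inS => [[[]|]|] [-> ->]; split; auto.
by move=> hx; left; have := h0 _ _ nS; move=> e; move: hx; rewrite e.
Qed.

Lemma square_del q x : q = b \/ q = b + 1 -> homog A a q x -> del A x = 0 -> x = 0.
Proof.
case: th => _ _ h _ hq hx dx.
have [||_ /(_ x 0) + _] := h a q; [by case: hq => -> /=; auto..|].
by apply; rewrite ?inE ?dx ?linear0 //; exact: (subspace0 (subspace_homog A a q)).
Qed.

Lemma square_delbar p x : p = a \/ p = a + 1 -> homog A p b x -> delbar A x = 0 -> x = 0.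
Proof.
case: th => _ _ _ h hp hx dx.
have [||_ /(_ x 0) + _] := h p b; [by case: hp => -> /=; auto..|].
by apply; rewrite ?inE ?dx ?linear0 //; exact: (subspace0 (subspace_homog A p b)).
Qed.

Lemma square_del_onto q x : q = b \/ q = b + 1 -> homog A (a + 1) q x ->
  exists2 y, homog A a q y & x = del A y.
Proof.
case: th => _ _ h _ hq hx.
have [||_ _ /(_ x hx) [y hy <-]] := h a q; [by case: hq => -> /=; auto..|].
by exists y.
Qed.

Lemma square_delbar_onto p x : p = a \/ p = a + 1 -> homog A p (b + 1) x ->
  exists2 y, homog A p b y & x = delbar A y.
Proof.
case: th => _ _ _ h hp hx.
have [||_ _ /(_ x hx) [y hy <-]] := h p b; [by case: hp => -> /=; auto..|].
by exists y.
Qed.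

Lemma square_hodge p q : hodge_spanned (0 : A) p q.
Proof.
apply: hodge_spanned0 => x hx dx.
have [->|[hp hq]] := square_degree hx.
  by exists 0; rewrite ?linear0 //; exact: (subspace0 (subspace_homog A _ _)).
case: hq => qb; subst q; last by rewrite addrK; exact: square_delbar_onto.
exists 0; first exact: (subspace0 (subspace_homog A _ _)).
by rewrite linear0; exact: square_delbar hp hx dx.
Qed.

(** At every corner but the last some outgoing arrow is injective, so a vector killed by both
    differentials is zero; at the last corner [del] and [delbar] are successively surjective. *)
Lemma square_bott_chern p q x : homog A p q x -> del A x = 0 -> delbar A x = 0 ->
  range (del A \o delbar A) x.
Proof.
move=> hx d1 d2; have s0 : range (del A \o delbar A) (0 : A) by exists 0; rewrite ?linear0.
have [->//|[hp hq]] := square_degree hx.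
case: hq => qb; subst q; first by rewrite (square_delbar hp hx d2).
case: hp => pa; subst p; first by rewrite (square_del _ hx d1) //; right.
have [|y hy ->] := square_del_onto _ hx; first by right.
by have [|z _ ->] := square_delbar_onto _ hy; [left|exists z].
Qed.

(** Dually, every corner but the first is the target of a surjective arrow, and at the first corner
    [del] after [delbar] is injective. *)
Lemma square_aeppli p q x : homog A p q x -> del A (delbar A x) = 0 ->
  sum_space (range (del A)) (range (delbar A)) x.
Proof.
move=> hx d12.
have r1 y : sum_space (range (del A)) (range (delbar A)) (del A y).
  by exists (del A y); [exists y|exists 0; [exists 0; rewrite ?linear0|rewrite addr0]].
have r2 y : sum_space (range (del A)) (range (delbar A)) (delbar A y).
  by exists 0; [exists 0; rewrite ?linear0|exists (delbar A y); [exists y|rewrite add0r]].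
have r0 : sum_space (range (del A)) (range (delbar A)) (0 : A).
  by have := r1 0; rewrite linear0.
have [->//|[hp hq]] := square_degree hx.
case: hq => qb; subst q; last by have [y _ ->] := square_delbar_onto hp hx.
case: hp => pa; subst p; last first.
  by have [|y _ ->] := square_del_onto _ hx; first by left.
have d2 : delbar A x = 0.
  by apply: (square_del (q := b + 1)) => //; [right|exact: delbar_bidegree].
by rewrite (square_delbar _ hx d2) //; left.
Qed.

End Square.

Lemma square_froelicher A r p q : is_square A ->
  invariant_num A (Froelicher r p q) `<=` invariant_den A (Froelicher r p q).
Proof.
move=> [a [b th]] x hx.
have [|c [_]] := page_spanned (linear0 (@total_d K A)) (@square_hodge _ _ _ th p q) _ hx.
  by move=> *; exact: linear0.
by rewrite scaler0 subr0.
Qed.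

Lemma square_bounded A : is_square A -> bounded_dc A.
Proof.
move=> [a [b th]]; exists (`|a| + `|b| + 2)%N => p q lt.
apply/seteqP; split=> [x /(square_degree th)[//|]|x ->]; first by lia.
exact: (subspace0 (subspace_homog A p q)).
Qed.

(** Varouchas numerators A, B and D lie in the Bott-Chern numerator, with the same denominator. The
    denominators of C, E and F contain the Aeppli denominator, with the same numerator. Betti
    numbers and pages are spanned by the class of 0. *)
Lemma square_acyclic A i : is_square A ->
  invariant_num A i `<=` invariant_den A i.
Proof.
move=> sqA; have bA := square_bounded sqA; have [a [b th]] := sqA.
have k1 (x : A) : range (del A) x -> del A x = 0 by case=> y _ <-; exact: del_del.
have k2 (x : A) : range (delbar A) x -> delbar A x = 0.
  by case=> y _ <-; exact: delbar_delbar.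
have bc := square_bott_chern th; have ae := square_aeppli th.
case: i => [n|p q|p q|p q|p q|p q|p q|p q|p q|p q|r p q|r p q] x.
- move=> [nx dx].
  have [||c] := betti_spanned (linear0 (@total_d K A)) bA _ _ nx dx.
  + by move=> p; exact: (square_hodge th).
  + by move=> *; exact: linear0.
  + by rewrite scaler0 subr0.
- move=> [dx hx]; have [y [c [_ -> _]]] := square_hodge th hx dx.
  by exists y => //; rewrite linear0 scaler0 addr0.
- by move=> [[d1 d2] hx]; exact: bc hx d1 d2.
- by move=> [d12 hx]; exact: ae hx d12.
- by move=> [[/k1 d1 /k2 d2] hx]; exact: bc hx d1 d2.
- by move=> [[/k1 d1 d2] hx]; exact: bc hx d1 d2.
- move=> [d12 hx]; have [u r1 [v r2 <-]] := ae _ _ _ hx d12.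
  by exists v; [exact: k2|exists u => //; rewrite addrC].
- by move=> [[d1 /k2 d2] hx]; exact: bc hx d1 d2.
- move=> [d12 hx]; have [u r1 [v r2 <-]] := ae _ _ _ hx d12.
  by exists u; [exact: k1|exists v].
- move=> [d12 hx]; have [u r1 [v r2 <-]] := ae _ _ _ hx d12.
  by exists v; [exact: k2|exists u; [exact: k1|rewrite addrC]].
- exact: square_froelicher.
- by rewrite conj_num conj_den; apply: square_froelicher; exact: swap_square.
Qed.

End Squares.

(** * Additivity and finiteness *)

Section DirectSums.
Variables (K : fieldType) (I : choiceType) (B : I -> double_complex K).
Variables (A : double_complex K) (f : forall i, B i -> A).
Hypothesis fS : is_direct_sum f.

Lemma finite_set_list (S : set I) : finite_set S ->
  exists r : seq I, uniq r /\ forall i, i \notin r -> ~ S i.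
Proof.
move=> fin; exists (fset_set S); split; first exact: fset_uniq.
by move=> i; rewrite in_fset_set // notin_setE.
Qed.

Definition coords (x : A) : forall i, B i := projT1 (cid (fS.2 x)).

Lemma coords_finite x : finite_set [set i | coords x i != 0].
Proof. by have [[]] := projT2 (cid (fS.2 x)). Qed.

Lemma coords_sum x : \sum_(i \in [set: I]) f (coords x i) = x.
Proof. by have [[]] := projT2 (cid (fS.2 x)). Qed.

Lemma coords_unique x (b : forall i, B i) (r : seq I) : uniq r ->
  (forall i, i \notin r -> b i = 0) -> x = \sum_(i <- r) f (b i) ->
  forall i, coords x i = b i.
Proof.
move=> ur br xE i; have [_ un] := projT2 (cid (fS.2 x)).
rewrite /coords (un b) //; split.
  apply: (@sub_finite_set _ _ [set` r]); last exact: finite_seq.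
  by move=> j /=; apply: contraNT => /br ->.
rewrite xE (fsum_support ur) // => j /br ->; exact: morphism0 (fS.1 j).
Qed.

Lemma coords_list x : exists r : seq I, [/\ uniq r,
  forall i, i \notin r -> coords x i = 0 & x = \sum_(i <- r) f (coords x i)].
Proof.
have [r [ur rP]] := finite_set_list (coords_finite x).
have rP' i : i \notin r -> coords x i = 0.
  by move=> /rP /negP; rewrite negbK => /eqP.
exists r; split=> //; rewrite -{1}(coords_sum x) (fsum_support ur) //.
by move=> i /rP' ->; exact: morphism0 (fS.1 i).
Qed.

Lemma coords_commute (u : {linear A -> A}) (w : forall i, {linear B i -> B i}) :
  (forall i y, f (w i y) = u (f y)) ->
  forall x i, coords (u x) i = w i (coords x i).
Proof.
move=> uw x; have [r [ur r0 xE]] := coords_list x.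
apply: (coords_unique (r := r)) => // [i /r0 ->|]; first exact: linear0.
by rewrite {1}xE linear_sum; apply: eq_bigr => i _; rewrite uw.
Qed.

(** Only the injections of a direct sum are given as morphisms; uniqueness of coordinates makes the
    projections morphisms too, and functoriality in both directions then splits the invariants. *)
Lemma coords_morphism i : dc_morphism (fun x => coords x i).
Proof.
split=> [c x y|p q x|x|x].
- have [r [ur r0 xE]] := coords_list x; have [s [us s0 yE]] := coords_list y.
  have wide (z : A) (t : seq I) : uniq t -> (forall j, j \notin t -> coords z j = 0) ->
      z = \sum_(j <- t) f (coords z j).
    move=> ut t0; rewrite -{1}(coords_sum z) (fsum_support ut) //.
    by move=> j /t0 ->; exact: morphism0 (fS.1 j).
  (* A common list for both supports lets the two expansions be added term by term. *)
  pose t := undup (r ++ s).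
  have tP j : j \notin t -> coords x j = 0 /\ coords y j = 0.
    by rewrite mem_undup mem_cat negb_or => /andP[/r0 + /s0].
  apply: (coords_unique (b := fun j => c *: coords x j + coords y j)
    (undup_uniq (r ++ s))).
    by move=> j /tP[-> ->]; rewrite scaler0 addr0.
  have xt := wide x t (undup_uniq _) (fun j h => (tP j h).1).
  have yt := wide y t (undup_uniq _) (fun j h => (tP j h).2).
  rewrite {1}xt {1}yt scaler_sumr -big_split; apply: eq_bigr => j _ /=.
  by have [g ->] := morphism_linear (fS.1 j); rewrite linearP.
- apply: (coords_commute (w := fun j => component (B j) p q)) => j y.
  by have [_ -> _ _] := fS.1 j.
- by apply: (coords_commute (w := fun j => del (B j))) => j y; have [_ _ -> _] := fS.1 j.
- by apply: (coords_commute (w := fun j => delbar (B j))) => j y; have [_ _ _ ->] := fS.1 j.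
Qed.

End DirectSums.

(** * Finiteness of the invariants and passage to the group *)

Section FiniteDimension.
Variable K : fieldType.
Implicit Types A B X Y Z : double_complex K.

(** Phrased with subspaces, finite generation is carried along a linear map by taking the preimage
    of a subspace. *)
Definition finitely_spanned A := exists l : seq A,
  forall W : set A, subspace W -> (forall v, v \in l -> W v) -> forall x, W x.

Lemma thin_finitely_spanned A S : finite_set S -> thin_on A S -> finitely_spanned A.
Proof.
move=> fS [h1 h0 _ _].
have /choice[e he] : forall pq, exists e : A,
    S pq -> forall x, homog A pq.1 pq.2 x -> exists c : K, x = c *: e.
  move=> [p q] /=.
  have [Spq|nS] := pselect (S (p, q)); last by exists 0.
  have [e _ hE] := h1 _ _ Spq; exists e => _ x; rewrite hE => -[c _ <-].
  by exists c.
exists (map e (fset_set S)) => W sW hW x.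
rewrite -(component_sum x); apply: subspace_fsum => // -[p q] /=.
have hx := component_homog p q x.
have [Spq|nS] := pselect (S (p, q)).
  have [c ->] := he _ Spq _ hx; apply: subspaceZ => //; apply: hW.
  by apply: map_f; rewrite in_fset_set // inE.
by move: hx; rewrite h0 // => ->; exact: subspace0.
Qed.

Lemma zigzag_finitely_spanned A : is_zigzag A -> finitely_spanned A.
Proof.
case=> [[p [q /thin_finitely_spanned h]]|[m [a [b [_ /thin_finitely_spanned h]]]]].
  exact/h/finite_set1.
apply/h/finite_image; apply: (@sub_finite_set _ _ [set` int_range a b]).
  by move=> j /=; rewrite mem_int_range.
exact: finite_seq.
Qed.

(** Each coordinate of a numerator vector is a numerator vector of its summand. On a square it falls
    into the denominator, so modulo the denominator the images of generators of the finitely many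
    zigzags span. *)
Lemma finite_num A i : finitely_many_zigzags A ->
  exists n, has_dim_quot (invariant_num A i) (invariant_den A i) n.
Proof.
move=> [I [B [f [fS sz finz]]]].
have [J [uJ hJ]] := finite_set_list finz.
have gen j : exists l : seq (B j), is_zigzag (B j) ->
    forall W : set (B j), subspace W -> (forall v, v \in l -> W v) -> forall x, W x.
  have [/zigzag_finitely_spanned [l hl]|nz] := pselect (is_zigzag (B j)).
    by exists l.
  by exists [::].
pose l j := projT1 (cid (gen j)); have hl j := projT2 (cid (gen j)).
pose L := flatten [seq map (f j) (l j) | j <- J].
apply: (finite_dim_quot (l := L) (subspace_num A i) (subspace_den A i)) => x nx.
have sL := span_mod_subspace L (subspace_den A i).
rewrite -(coords_sum fS x); apply: subspace_fsum => // j.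
have nj := morphism_num (coords_morphism fS j) nx.
have [sqj|zj] := sz j.
  by apply: sub_span_mod; apply: (morphism_den (fS.1 j)); exact: square_acyclic nj.
have [g gE] := morphism_linear (fS.1 j); rewrite gE.
apply: (hl j zj (g @^-1` span_mod (invariant_den A i) L)).
  exact: subspace_preimage.
move=> v vl /=; apply: mem_span_mod; first exact: subspace_den.
apply/flatten_mapP; exists j; last by rewrite gE map_f.
by apply: contrapT => /negP /hJ.
Qed.

Lemma inverse_morphism A B (f : A -> B) (g : B -> A) :
  dc_morphism f -> cancel f g -> cancel g f -> dc_morphism g.
Proof.
move=> fM fK gK; have [_ fc f1 f2] := fM; have finj := can_inj fK.
split=> [c x y|p q x|x|x]; apply: finj; rewrite ?gK ?fc ?f1 ?f2 ?gK //.
by have [h hE] := morphism_linear fM; rewrite hE linearP -hE !gK.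
Qed.

Lemma isomorphic_sym A B : isomorphic A B -> isomorphic B A.
Proof.
move=> [f fM [g fK gK]]; exists g; last by exists f.
exact: inverse_morphism fM fK gK.
Qed.

Lemma isomorphic_has_dim A B i n : isomorphic A B ->
  has_dim_quot (invariant_num A i) (invariant_den A i) n ->
  has_dim_quot (invariant_num B i) (invariant_den B i) n.
Proof.
move=> iso; have [f fM [g fK gK]] := iso.
have gM := inverse_morphism fM fK gK.
move=> [b [Pb hb]]; exists (f \o b); split=> [j|x nx].
  exact: morphism_num.
have [c [Qc uc]] := hb _ (morphism_num gM nx).
have fsum (d : 'rV[K]_n) : f (g x - \sum_(j < n) d 0 j *: b j) =
    x - \sum_(j < n) d 0 j *: (f \o b) j.
  rewrite -{2}(gK x); have [h hE] := morphism_linear fM.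
  rewrite hE linearB linear_sum; congr (_ - _).
  by apply: eq_bigr => j _; rewrite linearZ.
exists c; split; first by rewrite -fsum; exact: morphism_den.
move=> d; rewrite -fsum => hd; apply: uc.
by have := morphism_den gM hd; rewrite fK.
Qed.

(** The sets of admissible dimensions coincide, which also settles the infinite case, where the
    value is a default. *)
Lemma isomorphic_dim A B i : isomorphic A B -> invariant_dim A i = invariant_dim B i.
Proof.
move=> iso; rewrite !invariant_dimE /dim_quot; congr (xget _ _).
apply/seteqP; split=> n /=; first exact: isomorphic_has_dim.
by apply: isomorphic_has_dim; exact: isomorphic_sym.
Qed.

Section BinarySum.
Variables X Y : double_complex K.
Let Z := direct_sum X Y.

Lemma inl_morphism : dc_morphism (fun x : X => (x, 0) : Z).
Proof.
split=> [c x y|p q x|x|x]; last by rewrite /= /sum_map /= linear0.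
- by apply: (f_equal2 pair) => //=; rewrite scaler0 addr0.
- by rewrite /= /sum_map /= linear0.
- by rewrite /= /sum_map /= linear0.
Qed.

Lemma inr_morphism : dc_morphism (fun y : Y => (0, y) : Z).
Proof.
split=> [c x y|p q x|x|x]; last by rewrite /= /sum_map /= linear0.
- by apply: (f_equal2 pair) => //=; rewrite scaler0 addr0.
- by rewrite /= /sum_map /= linear0.
- by rewrite /= /sum_map /= linear0.
Qed.

Lemma fst_morphism : dc_morphism (fun z : Z => z.1 : X).
Proof. by []. Qed.

Lemma snd_morphism : dc_morphism (fun z : Z => z.2 : Y).
Proof. by []. Qed.

(** Functoriality along the two projections gives one direction, functoriality along the two
    inclusions the other. *)
Lemma sum_num i (z : Z) : invariant_num Z i z <->
  invariant_num X i z.1 /\ invariant_num Y i z.2.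
Proof.
split=> [h|[hx hy]].
  by split; [exact: (morphism_num fst_morphism)|exact: (morphism_num snd_morphism)].
have -> : z = (z.1, 0) + (0, z.2) by case: (z) => x y; congr pair; rewrite ?addr0 ?add0r.
apply: (subspaceD (subspace_num Z i)); first exact: (morphism_num inl_morphism).
exact: (morphism_num inr_morphism).
Qed.

Lemma sum_den i (z : Z) : invariant_den Z i z <->
  invariant_den X i z.1 /\ invariant_den Y i z.2.
Proof.
split=> [h|[hx hy]].
  by split; [exact: (morphism_den fst_morphism)|exact: (morphism_den snd_morphism)].
have -> : z = (z.1, 0) + (0, z.2) by case: (z) => x y; congr pair; rewrite ?addr0 ?add0r.
apply: (subspaceD (subspace_den Z i)); first exact: (morphism_den inl_morphism).
exact: (morphism_den inr_morphism).
Qed.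

Lemma sum_has_dim i n m :
  has_dim_quot (invariant_num X i) (invariant_den X i) n ->
  has_dim_quot (invariant_num Y i) (invariant_den Y i) m ->
  has_dim_quot (invariant_num Z i) (invariant_den Z i) (n + m).
Proof.
move=> [a [Pa ha]] [b [Pb hb]].
pose e (j : 'I_(n + m)) : Z := match fintype.split j with inl j => (a j, 0) | inr j => (0, b j) end.
have sumE (d : 'rV[K]_(n + m)) : \sum_j d 0 j *: e j =
    (\sum_j lsubmx d 0 j *: a j, \sum_j rsubmx d 0 j *: b j).
  have pairE (r : seq 'I_(n + m)) : \sum_(j <- r) d 0 j *: e j =
      (\sum_(j <- r) d 0 j *: (e j).1, \sum_(j <- r) d 0 j *: (e j).2) :> X * Y.
    by elim: r => [|j r IH]; rewrite ?big_nil // !big_cons IH.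
  rewrite pairE !big_split_ord /=; congr pair.
    rewrite [X in _ + X]big1 ?addr0 => [|j _].
      by apply: eq_bigr => j _; rewrite /e (unsplitK (inl j)) mxE.
    by rewrite /e (unsplitK (inr j)) scaler0.
  rewrite big1 ?add0r => [|j _].
    by apply: eq_bigr => j _; rewrite /e (unsplitK (inr j)) mxE.
  by rewrite /e (unsplitK (inl j)) scaler0.
exists e; split=> [j|z].
  rewrite /e; case: (fintype.split j) => k; first exact: (morphism_num inl_morphism).
  exact: (morphism_num inr_morphism).
move/sum_num => [hx hy].
have [c [Qc uc]] := ha _ hx; have [d [Qd ud]] := hb _ hy.
exists (row_mx c d); split.
  by rewrite sumE row_mxKl row_mxKr; apply/sum_den.
move=> w; rewrite sumE => /sum_den[/= /uc -> /ud ->]; exact: hsubmxK.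
Qed.

End BinarySum.

(** Finiteness enters here: the default value 0 of an infinite quotient would break additivity. *)
Lemma direct_sum_dim (X Y : bdd_fin_complex K) i :
  invariant_dim (direct_sum X Y) i = (invariant_dim X i + invariant_dim Y i)%N.
Proof.
have [n hn] := finite_num i (bfc_finite X); have [m hm] := finite_num i (bfc_finite Y).
have dE A := dim_quotE (subspace_num A i) (subspace_den A i).
by rewrite !invariant_dimE (dE _ _ hn) (dE _ _ hm); exact: dE (sum_has_dim hn hm).
Qed.

Lemma chi_expr_ueq (x y : uexpr K) : ueq x y -> chi_expr x = chi_expr y.
Proof.
elim=> {x y} //=.
- by move=> x y z _ -> _ ->.
- by move=> x y _ ->.
- by move=> x x' y y' _ -> _ ->.
- by move=> x y z; rewrite addrA.
- by move=> x y; rewrite addrC.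
- by move=> x; rewrite add0r.
- by move=> x; rewrite addNr.
- by move=> X Y iso; apply: funext => i; rewrite (isomorphic_dim i iso).
- move=> X Y Z iso; apply: funext => i.
  by rewrite (isomorphic_dim i iso) direct_sum_dim PoszD.
- move=> X sqX; apply: funext => i; rewrite invariant_dimE dim_quot_sub //.
  + exact: subspace_num.
  + exact: subspace_den.
  + exact: square_acyclic.
Qed.

Lemma chi_upi (x : uexpr K) : chi (upi x) = chi_expr x.
Proof.
apply: chi_expr_ueq; rewrite /urepr; case: cid => y /= xy.
by apply: ueq_sym; rewrite xy; exact: ueq_refl.
Qed.

End FiniteDimension.

(** * Complexes with monomial differentials *)

Section PathComplexes.
Variables (K : fieldType) (m : int) (s : seq (int * int)).
Hypothesis s_deg : all (fun x : int * int => (x.1 + x.2 == m) || (x.1 + x.2 == m + 1)) s.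

Let A := path_complex K s_deg.

Definition entry (x : A) (y : int * int) : K := pcoord (x : {ffun seq_sub s -> K^o}) y.

Lemma entry_inj (x y : A) : (forall z, entry x z = entry y z) -> x = y.
Proof. by move=> h; apply/ffunP => t; rewrite -!coordE; exact: h. Qed.

Lemma entry_notin (x : A) y : y \notin s -> entry x y = 0.
Proof. exact: coord_out. Qed.

Lemma entry_lin c (x y : A) z : entry (c *: x + y) z = c * entry x z + entry y z.
Proof. exact: coord_linear. Qed.

Lemma entry0 z : entry 0 z = 0.
Proof. by rewrite /entry /pcoord; case: insub => // t; rewrite ffunE. Qed.

Lemma entryD (x y : A) z : entry (x + y) z = entry x z + entry y z.
Proof. by rewrite -[x]scale1r entry_lin mul1r scale1r. Qed.

Lemma entryZ c (x : A) z : entry (c *: x) z = c * entry x z.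
Proof. by rewrite -[c *: x]addr0 entry_lin entry0 addr0. Qed.

Lemma entryB (x y : A) z : entry (x - y) z = entry x z - entry y z.
Proof. by rewrite entryD -scaleN1r entryZ mulN1r. Qed.

Lemma entry_del (x : A) y :
  entry (del A x) y = if y \in s then entry x (y.1 - 1, y.2) else 0.
Proof. exact: coord_del. Qed.

Lemma entry_delbar (x : A) y :
  entry (delbar A x) y = if y \in s then entry x (y.1, y.2 - 1) else 0.
Proof. exact: coord_delbar. Qed.

Lemma entry_component p q (x : A) y :
  entry (component A p q x) y = if y == (p, q) then entry x y else 0.
Proof.
rewrite /entry {1}/pcoord; case: insubP => [t ys ty|ys].
  by rewrite ffunE ty -coordE ty.
by rewrite coord_out // if_same.
Qed.

Lemma homogP p q (x : A) : homog A p q x <-> forall y, y != (p, q) -> entry x y = 0.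
Proof. exact: homog_coord. Qed.

Definition vector_of (g : int * int -> K) : A :=
  [ffun t : seq_sub s => g (val t) : K^o].

Lemma entry_vector_of g y : entry (vector_of g) y = if y \in s then g y else 0.
Proof.
rewrite /entry {1}/pcoord; case: insubP => [t ys ty|ys].
  by rewrite ffunE ty ys.
by rewrite (negbTE ys).
Qed.

(** Entries off [s] vanish anyway, so the value of [T] there is irrelevant: kernels and images are
    described by neighbours alone, and membership in [s] reappears only in [coord_space_dim]. *)
Definition coord_space (T : pred (int * int)) : set A :=
  [set x | forall y, ~~ T y -> entry x y = 0].

Lemma subspace_coord_space T : subspace (coord_space T).
Proof.
split=> [y _|c x y hx hy z Tz]; first exact: entry0.
by rewrite entry_lin hx // hy // mulr0 addr0.
Qed.

Lemma coord_spaceI T U :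
  coord_space T `&` coord_space U = coord_space (fun y => T y && U y).
Proof.
apply/seteqP; split=> x.
  by move=> [hT hU] y; rewrite negb_and => /orP[/hT|/hU].
by move=> h; split=> y /negbTE ny; apply: h; rewrite ny ?andbF.
Qed.

Lemma coord_spaceD T U :
  sum_space (coord_space T) (coord_space U) = coord_space (fun y => T y || U y).
Proof.
apply/seteqP; split=> [_ [a ha [b hb <-]] y|x hx].
  by rewrite negb_or => /andP[/ha h1 /hb h2]; rewrite entryD h1 h2 addr0.
exists (vector_of (fun y => if T y then entry x y else 0)).
  by move=> y /negbTE Ty; rewrite entry_vector_of Ty if_same.
exists (vector_of (fun y => if T y then 0 else entry x y)).
  move=> y /negbTE Uy; rewrite entry_vector_of; case: ifP => // _.
  by case: ifPn => // Ty; rewrite hx // negb_or Ty Uy.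
apply: entry_inj => y; rewrite entryD !entry_vector_of; case: ifPn => ys.
  by case: ifP => _; rewrite ?addr0 ?add0r.
by rewrite addr0 entry_notin.
Qed.

Lemma kernel_del : kernel_set (del A) = coord_space (fun y => (y.1 + 1, y.2) \notin s).
Proof.
apply/seteqP; split=> x hx.
  move=> [a b]; rewrite negbK /= => ys.
  have /(congr1 (entry^~ (a + 1, b))) := hx.
  by rewrite entry_del ys entry0 /= addrK.
apply: entry_inj => -[a b]; rewrite entry_del entry0; case: ifP => // ys.
by apply: hx; rewrite negbK /= subrK.
Qed.

Lemma kernel_delbar :
  kernel_set (delbar A) = coord_space (fun y => (y.1, y.2 + 1) \notin s).
Proof.
apply/seteqP; split=> x hx.
  move=> [a b]; rewrite negbK /= => ys.
  have /(congr1 (entry^~ (a, b + 1))) := hx.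
  by rewrite entry_delbar ys entry0 /= addrK.
apply: entry_inj => -[a b]; rewrite entry_delbar entry0; case: ifP => // ys.
by apply: hx; rewrite negbK /= subrK.
Qed.

Lemma range_del : range (del A) = coord_space (fun y => (y.1 - 1, y.2) \in s).
Proof.
apply/seteqP; split=> [_ [x _ <-] y ny|x hx].
  by rewrite entry_del entry_notin // if_same.
exists (vector_of (fun y => entry x (y.1 + 1, y.2))) => //.
apply: entry_inj => -[a b]; rewrite entry_del entry_vector_of /= subrK.
case: ifPn => [_|/entry_notin -> //]; case: ifPn => // ny.
by rewrite (hx (a, b)).
Qed.

Lemma range_delbar : range (delbar A) = coord_space (fun y => (y.1, y.2 - 1) \in s).
Proof.
apply/seteqP; split=> [_ [x _ <-] y ny|x hx].
  by rewrite entry_delbar entry_notin // if_same.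
exists (vector_of (fun y => entry x (y.1, y.2 + 1))) => //.
apply: entry_inj => -[a b]; rewrite entry_delbar entry_vector_of /= subrK.
case: ifPn => [_|/entry_notin -> //]; case: ifPn => // ny.
by rewrite (hx (a, b)).
Qed.

(** The composite raises the total degree by two, while [s] meets only two consecutive degrees. *)
Lemma path_del_delbar0 (x : A) : (del A \o delbar A) x = 0.
Proof.
apply: entry_inj => -[a b]; rewrite /= entry_del entry_delbar entry0 /=.
case: ifP => // ys; case: ifP => // _; apply: entry_notin.
by apply: (degree_out s_deg ys) => /=; lia.
Qed.

Lemma kernel_del_delbar : kernel_set (del A \o delbar A) = coord_space predT.
Proof. by apply/seteqP; split=> x hx //; exact: path_del_delbar0. Qed.

Lemma range_del_delbar : range (del A \o delbar A) = coord_space pred0.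
Proof.
apply/seteqP; split=> [_ [x _ <-] y _|x hx].
  by rewrite path_del_delbar0 entry0.
exists 0 => //; rewrite path_del_delbar0.
by apply: entry_inj => y; rewrite entry0 hx.
Qed.

Lemma coord_space_dim T U p q :
  dim_quot (coord_space T `&` homog A p q) (coord_space U) =
  ((p, q) \in s) && T (p, q) && ~~ U (p, q).
Proof.
have sP := subspaceI (subspace_coord_space T) (subspace_homog A p q).
have sU := subspace_coord_space U.
have [/andP[/andP[ys Ty] Uy]|ny] := boolP (((p, q) \in s) && T (p, q) && ~~ U (p, q));
  last first.
  apply: dim_quot_sub => // x [hT /homogP hx] y Uy.
  have [ye|/hx //] := eqVneq y (p, q); rewrite ye in Uy *.
  have [ys|/entry_notin //] := boolP ((p, q) \in s).
  by apply: hT; apply: contra ny => Ty; rewrite ys Ty Uy.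
pose e := vector_of (fun y => (y == (p, q))%:R).
have eE y : entry e y = (y == (p, q))%:R.
  by rewrite entry_vector_of; case: eqP => [->|_]; rewrite ?ys // if_same.
apply: (dim_quot_line (e := e)) => //.
- split; last by apply/homogP => y /negbTE ny; rewrite eE ny.
  by move=> y; rewrite eE; case: eqP => // ->; rewrite Ty.
- by move=> /(_ _ Uy) /eqP; rewrite eE eqxx oner_eq0.
- move=> x [_ /homogP hx]; exists (entry x (p, q)) => y _.
  rewrite entryB entryZ eE; case: eqP => [->|/eqP ne]; first by rewrite mulr1 subrr.
  by rewrite hx // mulr0 subr0.
Qed.

Definition path_coordE := (kernel_del_delbar, range_del_delbar, kernel_del,
  kernel_delbar, range_del, range_delbar, coord_spaceI, coord_spaceD, coord_space_dim).

(** Each bigraded invariant is 0 or 1 according to which of the four neighbours are in the support.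
    The value on Betti and page indices is a default, excluded by [is_bidegree_invariant]. *)
Definition path_dim (T : pred (int * int)) (i : dc_invariant) : bool :=
  let out1 p q := T (p + 1, q) in let out2 p q := T (p, q + 1) in
  let in1 p q := T (p - 1, q) in let in2 p q := T (p, q - 1) in
  match i with
  | Hodge p q => [&& T (p, q), ~~ out2 p q & ~~ in2 p q]
  | BottChern p q => [&& T (p, q), ~~ out1 p q & ~~ out2 p q]
  | Aeppli p q => [&& T (p, q), ~~ in1 p q & ~~ in2 p q]
  | VarouchasA p q => [&& T (p, q), in1 p q & in2 p q]
  | VarouchasB p q => [&& T (p, q), in1 p q & ~~ out2 p q]
  | VarouchasC p q => [&& T (p, q), ~~ in1 p q & out2 p q]
  | VarouchasD p q => [&& T (p, q), in2 p q & ~~ out1 p q]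
  | VarouchasE p q => [&& T (p, q), ~~ in2 p q & out1 p q]
  | VarouchasF p q => [&& T (p, q), out1 p q & out2 p q]
  | _ => false
  end.

Definition is_bidegree_invariant (i : dc_invariant) : bool :=
  match i with Betti _ | Froelicher _ _ _ | ConjFroelicher _ _ _ => false | _ => true end.

Lemma path_invariant_dim i : is_bidegree_invariant i -> invariant_dim A i = path_dim (mem s) i.
Proof.
rewrite invariant_dimE; case: i => [n|p q|p q|p q|p q|p q|p q|p q|p q|p q|r p q|r p q] //= _;
  rewrite !path_coordE /=; do ![case: (_ \in _) => //].
Qed.

(** A vertical neighbour kills the class: if it lies above, closed vectors vanish at (p, q); if it
    lies below, every vector there is a [delbar]-boundary. *)
Lemma path_hodge_spanned e p q :
  ((p, q) \in s -> ((p, q + 1) \in s) || ((p, q - 1) \in s)) ->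
  @hodge_spanned K A e p q.
Proof.
move=> H x /homogP hx dx.
(* The vector [x] moved one step down; it is truncated to 0 when no neighbour lies below. *)
exists (vector_of (fun y => if y == (p, q - 1) then entry x (p, q) else 0)), 0.
split; [|rewrite scale0r addr0|by left].
  by apply/homogP => y /negbTE ny; rewrite entry_vector_of ny if_same.
apply: entry_inj => -[a b]; rewrite entry_delbar entry_vector_of /=.
case: ifPn => [ys|/entry_notin //].
have [[ea eb]|ne] := eqVneq (a, b) (p, q); last first.
  rewrite hx // xpair_eqE (inj_eq (addIr _)) -xpair_eqE (negbTE ne).
  by rewrite if_same.
rewrite ea eb eqxx in ys *; case: ifPn => // ny.
have /orP[os|/idPn //] := H ys.
have : kernel_set (delbar A) x by [].
by rewrite kernel_delbar => /(_ (p, q)); rewrite /= os; exact.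
Qed.

Lemma path_hodge_spanned_at e p q : entry e (p, q) != 0 -> filtration1 p e ->
  @hodge_spanned K A e p q.
Proof.
move=> ne Fe x /homogP hx dx.
exists 0, (entry x (p, q) / entry e (p, q)); split; last by right.
  exact: (subspace0 (subspace_homog A _ _)).
rewrite linear0 add0r; apply: entry_inj => y; rewrite entryZ entry_component.
by case: eqP => [->|/eqP /hx ->]; rewrite ?mulr0 // divfK.
Qed.

End PathComplexes.

Section SwapPath.
Variables (K : fieldType) (m : int) (s s' : seq (int * int)).
Hypothesis s_deg : all (fun x : int * int => (x.1 + x.2 == m) || (x.1 + x.2 == m + 1)) s.
Hypothesis s_deg' : all (fun x : int * int => (x.1 + x.2 == m) || (x.1 + x.2 == m + 1)) s'.
Hypothesis ss' : forall y, (y \in s') = ((y.2, y.1) \in s).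

Let A := path_complex K s_deg.
Let A' := path_complex K s_deg'.

(** Transposition of the basis. The two support lists need only correspond as sets, since
    transposing a zigzag reverses its order. *)
Lemma swap_path_isomorphic : isomorphic (swap_dc A) A'.
Proof.
pose f (x : A) : A' := vector_of s_deg' (fun y => entry x (y.2, y.1)).
pose g (x : A') : A := vector_of s_deg (fun y => entry x (y.2, y.1)).
have fE x y : entry (f x) y = entry x (y.2, y.1).
  rewrite entry_vector_of ss'; case: ifPn => // /entry_notin -> //.
have gE x y : entry (g x) y = entry x (y.2, y.1).
  case: y => a b; rewrite entry_vector_of; case: ifPn => // ys.
  by rewrite entry_notin // ss'.
exists f; last first.
  exists g => x; apply: entry_inj => -[a b]; first by rewrite gE fE.
  by rewrite fE gE.
split=> [c x y|p q x|x|x]; apply: entry_inj => -[a b].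
- by rewrite fE !entry_lin !fE.
- by rewrite fE !entry_component fE !xpair_eqE andbC.
- by rewrite fE entry_delbar entry_del fE ss'.
- by rewrite fE entry_delbar entry_del fE ss'.
Qed.

End SwapPath.

(** * The zigzags Z_k^{p,q} *)

(** On a fixed antidiagonal a bound on [a] by [k - q] is a bound on [b] by [q]; in this form the
    support is visibly symmetric under exchange of the degrees. *)
Lemma mem_Z_support k p q a b : ((a, b) \in Z_support k p q) =
  if k < p + q then (a + b == k) && (a <= p) && (b <= q) ||
                    (a + b == k - 1) && (a < p) && (b < q)
  else (a + b == k) && (p <= a) && (q <= b) ||
       (a + b == k + 1) && (p < a) && (q < b).
Proof.
rewrite /Z_support; case: ifP => h; rewrite mem_cat; congr (_ || _);
  apply/mapP/idP => [[r]|hab]; try (rewrite mem_int_range => hr [-> ->]; lia);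
  by exists a; [rewrite mem_int_range; lia|congr pair; lia].
Qed.

Lemma swap_Z_support k p q y : (y \in Z_support k q p) = ((y.2, y.1) \in Z_support k p q).
Proof. by case: y => a b; rewrite !mem_Z_support (addrC q p) /=; case: ifP => _; lia. Qed.

Section ZComplex.
Variables (K : fieldType) (k p q : int).

Let A := Z_complex K k p q.

Lemma entry_total_d (x : A) a b : entry (total_d x) (a, b) =
  if (a, b) \in Z_support k p q
  then entry x (a - 1, b) + entry x (a, b - 1) else 0.
Proof. by rewrite entryD entry_del entry_delbar; case: ifP; rewrite ?addr0. Qed.

Lemma entry_filtration1 (x : A) r a b : filtration1 r x -> a < r -> entry x (a, b) = 0.
Proof.
move=> h lt; have := congr1 (fun z => entry z (a, b)) (h a b lt).
by rewrite /= entry_component eqxx entry0.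
Qed.

(* A generator of the total cohomology: the end point of the zigzag when
   k < p + q, and the alternating sum of the sources otherwise. *)
Definition is_Z_class (e : A) :=
  [/\ total_d e = 0, total_degree k e, filtration1 p e,
      entry e (p, k - p) != 0 &
      forall y, ~ filtration1 (p + 1) (e - total_d y)].

Lemma entry_filtration1_of (x : A) r :
  (forall a b, a < r -> entry x (a, b) = 0) -> filtration1 r x.
Proof.
move=> h a b lt; apply: entry_inj => y; rewrite entry_component entry0.
by case: eqP => // ->; exact: h.
Qed.

Lemma entry_total_degree (x : A) n :
  (forall a b, a + b != n -> entry x (a, b) = 0) -> total_degree n x.
Proof.
move=> h a b ne; apply: entry_inj => y; rewrite entry_component entry0.
by case: eqP => // ->; exact: h.
Qed.

(** Here the sources have degree k - 1 and the targets degree k, one more target than sources. The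
    last target is closed, and solving for a primitive from the opposite end forces all its
    coefficients to vanish. *)
Lemma Z_class_plus : k < p + q -> exists e, is_Z_class e.
Proof.
move=> kpq.
pose e : A := vector_of _ (fun y => (y == (p, k - p))%:R).
have eE y : entry e y = (y == (p, k - p))%:R.
  rewrite entry_vector_of; case: eqP => [->|_]; last by rewrite if_same.
  by rewrite mem_Z_support kpq ifT //; lia.
exists e; split.
- apply: entry_inj => -[a b]; rewrite entry_total_d entry0 !eE !xpair_eqE.
  case: ifP => //; rewrite mem_Z_support kpq => ys.
  have -> : (a - 1 == p) && (b == k - p) = false by lia.
  have -> : (a == p) && (b - 1 == k - p) = false by lia.
  exact: addr0.
- apply: entry_total_degree => a b ne; rewrite eE xpair_eqE.
  by rewrite [_ && _](_ : _ = false) //; lia.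
- apply: entry_filtration1_of => a b lt; rewrite eE xpair_eqE.
  by rewrite [_ && _](_ : _ = false) //; lia.
- by rewrite eE eqxx oner_neq0.
- move=> y Fy.
  have step (a : int) : k - q <= a -> a <= p ->
      (a == p)%:R - (entry y (a - 1, k - a) + entry y (a, k - a - 1)) = 0 :> K.
    move=> h1 h2; have lt : a < p + 1 by lia.
    have := entry_filtration1 (k - a) Fy lt.
    rewrite entryB entry_total_d eE xpair_eqE ifT; last by rewrite mem_Z_support kpq; lia.
    by have -> : (a == p) && (k - a == k - p) = (a == p) by lia.
  (* The index i walks along the sources; i = 0 is the position just outside the support at the far
     end, where the entry vanishes for free. *)
  have zero (i : nat) : k - q - 1 + i%:Z <= p - 1 ->
      entry y (k - q - 1 + i%:Z, q - i%:Z) = 0.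
    elim: i => [|i IH] hi; first by rewrite entry_notin // mem_Z_support kpq; lia.
    have h1 : k - q <= k - q + i%:Z by lia.
    have h2 : k - q + i%:Z <= p by lia.
    have := step _ h1 h2.
    rewrite [_ == p](_ : _ = false) ?sub0r; last by lia.
    have -> : k - q + i%:Z - 1 = k - q - 1 + i%:Z by lia.
    have -> : k - (k - q + i%:Z) = q - i%:Z by lia.
    rewrite IH ?add0r; last by lia.
    move=> /eqP; rewrite oppr_eq0 => /eqP <-; congr (entry _ (_, _)); lia.
  have h : k - q <= p by lia.
  have h' : p <= p by lia.
  have := step p h h'.
  rewrite [X in _ - (_ + X)]entry_notin ?addr0; last by rewrite mem_Z_support kpq; lia.
  (* After p + q - k steps the walk reaches (p - 1, k - p), the only source mapping to the last
     target. *)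
  have := zero (absz (p + q - k)%R).
  have -> : k - q - 1 + (absz (p + q - k)%R)%:Z = p - 1 by lia.
  have -> : q - (absz (p + q - k)%R)%:Z = k - p by lia.
  move=> -> //; rewrite eqxx subr0; exact/eqP/oner_neq0.
Qed.

(** Here the sources have degree k and nothing maps into them, so a boundary cannot alter the entry
    of the class in column p. *)
Lemma Z_class_minus : p + q <= k -> exists e, is_Z_class e.
Proof.
move=> pqk; have memE a b : ((a, b) \in Z_support k p q) =
    (a + b == k) && (p <= a) && (q <= b) || (a + b == k + 1) && (p < a) && (q < b).
  by rewrite mem_Z_support ifF //; lia.
(* Consecutive sources share a target, so alternating signs make the sum closed. *)
pose sg (a : int) : K := if (a %% 2)%Z == 0 then 1 else -1.
have sgS a : sg (a - 1) + sg a = 0.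
  rewrite /sg; case: ifP => h1; case: ifP => h2; rewrite ?subrr ?addNr //; lia.
have sg0 a : sg a != 0 by rewrite /sg; case: ifP; rewrite ?oppr_eq0 oner_neq0.
pose e : A := vector_of _ (fun y => if y.1 + y.2 == k then sg y.1 else 0).
exists e; split.
- apply: entry_inj => -[a b]; rewrite entry_total_d entry0 !entry_vector_of /=.
  case: ifP => //; rewrite !memE => ys.
  have [ab|ab] := eqVneq (a + b) (k + 1).
    rewrite !ifT; [|lia..]; exact: sgS.
  rewrite ![if a - 1 + b == k then _ else _]ifF; last by lia.
  rewrite ![if a + (b - 1) == k then _ else _]ifF; last by lia.
  by rewrite !if_same addr0.
- apply: entry_total_degree => a b /negbTE ne; rewrite entry_vector_of /= ne.
  by rewrite if_same.
- apply: entry_filtration1_of => a b lt; rewrite entry_vector_of ifF //.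
  by rewrite memE; lia.
- rewrite entry_vector_of memE !ifT //=; lia.
- move=> y Fy; have lt : p < p + 1 by lia.
  have := entry_filtration1 (k - p) Fy lt.
  rewrite entryB entry_total_d entry_vector_of memE.
  rewrite !ifT /=; [|lia..].
  rewrite !entry_notin ?addr0 ?subr0; first exact/eqP.
    by rewrite memE; lia.
  by rewrite memE; lia.
Qed.

Lemma Z_class : exists e, is_Z_class e.
Proof. by have [/Z_class_minus|/Z_class_plus] := leP (p + q) k. Qed.

(** The vertical arrows pair off all vertices of the zigzag except (p, k - p), for both shapes. *)
Lemma Z_hodge_spanned e a b : (a, b) != (p, k - p) -> @hodge_spanned K A e a b.
Proof.
rewrite xpair_eqE => ne; apply: path_hodge_spanned; rewrite !mem_Z_support.
by case: ifP; lia.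
Qed.

(** A closed class is a cycle on every page. A page boundary is a true boundary plus a vector of the
    next filtration step, which is why [is_Z_class] excludes [e - total_d y] from that step instead
    of merely excluding exactness. *)
Lemma Z_froelicher_dim r a b :
  invariant_dim A (Froelicher r a b) = ((a == p) && (b == k - p)).
Proof.
have [e [de ne Fe ce obs]] := Z_class.
have sN := subspace_num A (Froelicher r a b); have sD := subspace_den A (Froelicher r a b).
rewrite invariant_dimE -xpair_eqE; have [[ea eb]|neq] := eqVneq (a, b) (p, k - p).
  have kE : k = a + b by rewrite ea eb addrC subrK.
  apply: (dim_quot_line (e := e)) => //.
  - by split; rewrite -?kE ?ea // de; exact: (subspace0 (subspace_filtration1 _ _)).
  - case=> z [_ Fz _] [_ [y _ <-]] eE; apply: (obs y).
    by rewrite -eE addrK -ea.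
  - move=> x hx; have [||c [_ hc]] := page_spanned de _ _ hx.
    + by rewrite ea eb; exact: path_hodge_spanned_at.
    + by rewrite -kE.
    + by exists c.
apply: dim_quot_sub => // x hx.
have [||c [_]] := page_spanned (linear0 (@total_d K A)) _ _ hx.
- exact: Z_hodge_spanned.
- by move=> *; exact: linear0.
- by rewrite scaler0 subr0.
Qed.

Lemma Z_betti_dim n : invariant_dim A (Betti n) = (n == k).
Proof.
have [e [de ne Fe ce obs]] := Z_class.
have bA : bounded_dc A := path_complex_bounded K (Z_support_degree k p q).
have sN := subspace_num A (Betti n); have sD := subspace_den A (Betti n).
rewrite invariant_dimE; have [nk|nk] := eqVneq n k.
  apply: (dim_quot_line (e := e)) => //; first by rewrite nk.
  - case=> y _ yE; apply: (obs y); rewrite yE subrr => a b _; exact: linear0.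
  - move=> x [nx dx]; apply: (betti_spanned de bA _ _ nx dx); last by rewrite nk.
    move=> a; have [->|ap] := eqVneq a p; first by rewrite nk; exact: path_hodge_spanned_at.
    by apply: Z_hodge_spanned; rewrite xpair_eqE (negbTE ap).
apply: dim_quot_sub => // x [nx dx].
have [||c] := betti_spanned (linear0 (@total_d K A)) bA _ _ nx dx.
- by move=> a; apply: Z_hodge_spanned; rewrite xpair_eqE; lia.
- by move=> *; exact: linear0.
- by rewrite scaler0 subr0.
Qed.

End ZComplex.

Lemma Z_conj_dim (K : fieldType) k p q r a b :
  invariant_dim (Z_complex K k p q) (ConjFroelicher r a b) =
  ((b == q) && (a == k - q)).
Proof.
have iso : isomorphic (swap_dc (Z_complex K k p q)) (Z_complex K k q p).
  (* The lower degree of a path complex is a parameter computed from [p + q] or [q + p]; the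
     rewriting makes the two parameters agree. *)
  rewrite /Z_complex; move: (Z_support_degree k q p); rewrite (addrC q p) => deg.
  by apply: swap_path_isomorphic => y; exact: swap_Z_support.
have -> : invariant_dim (Z_complex K k p q) (ConjFroelicher r a b) =
    invariant_dim (swap_dc (Z_complex K k p q)) (Froelicher r b a).
  by rewrite !invariant_dimE conj_num conj_den.
by rewrite (isomorphic_dim _ iso) Z_froelicher_dim.
Qed.

(** * Separation of the variables p and q *)

Definition separable (D : rel int) (f : int -> int -> int) :=
  exists u w : int -> int, forall p q, D p q -> f p q = u p + w q.

Lemma separable0 (D : rel int) f : (forall p q, D p q -> f p q = 0) -> separable D f.
Proof. by move=> h; exists (fun=> 0), (fun=> 0) => p q /h ->. Qed.

Lemma separable_l (D : rel int) f (u : int -> int) :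
  (forall p q, D p q -> f p q = u p) -> separable D f.
Proof. by move=> h; exists u, (fun=> 0) => p q /h ->; rewrite addr0. Qed.

(* If X or Y always holds, then the indicator of X && Y is X + Y - 1. *)
Lemma separable_and (D f : rel int) (X Y : pred int) :
  (forall p q, D p q -> (X p || Y q) && (f p q == X p && Y q)) ->
  separable D (fun p q => (f p q : nat)%:Z).
Proof.
move=> h; exists (fun p => (X p : nat)%:Z), (fun q => (Y q : nat)%:Z - 1) => p q /h.
by case: (X p) (Y q) => -[] //= /eqP ->.
Qed.

Definition region (b : bool) (k p q : int) : bool := if b then k < p + q else p + q < k.

(** Tests one candidate pair; arithmetic must confirm both that one condition always holds on the
    region and that the indicator is the conjunction. *)
Ltac try_sep memE X Y :=
  apply: (separable_and (X := X) (Y := Y)); let h := fresh in intros ? ? h;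
  rewrite !(memE _ _ _ _ h); move: h; rewrite /region; lia.

(** For p + q > k, having x >= p and y >= q would give x + y > k, so at least one of two upper
    bounds holds on the antidiagonals met by the zigzag; for p + q < k all inequalities are
    reversed. *)
Lemma path_dim_separable b k i : is_bidegree_invariant i ->
  separable (region b k) (fun p q => (path_dim (mem (Z_support k p q)) i : nat)%:Z).
Proof.
have memE p q x y : region b k p q -> mem (Z_support k p q) (x, y) =
    if b then (x + y == k) && (x <= p) && (y <= q) || (x + y == k - 1) && (x < p) && (y < q)
    else (x + y == k) && (p <= x) && (q <= y) || (x + y == k + 1) && (p < x) && (q < y).
  move=> h; rewrite -[LHS]/((x, y) \in Z_support k p q) mem_Z_support.
  by move: h; rewrite /region; case: b => h; rewrite ?h // ifF //; lia.
(* Off the antidiagonals k - 1, k and k + 1 the bidegree is never in the support. *)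
case: b memE => memE; case: i => // x y _; rewrite /path_dim;
  (have [e|ne] := eqVneq (x + y) k; last have [e'|ne'] := eqVneq (x + y) (k - 1);
     last have [e''|ne''] := eqVneq (x + y) (k + 1)).
(* Which inequalities are strict depends on the neighbours required or forbidden, so the pair is
   found by search. The pair with [x == p] serves the Hodge numbers, on which q imposes no
   condition. *)
all: first
  [ by apply: separable0 => p q h; rewrite !(memE _ _ _ _ h); move: h; rewrite /region; lia
  | try_sep memE (fun p => x == p) (fun q : int => true)
  | try_sep memE (fun p => x <= p) (fun q => y <= q)
  | try_sep memE (fun p => x <= p) (fun q => y < q)
  | try_sep memE (fun p => x < p) (fun q => y <= q)
  | try_sep memE (fun p => x < p) (fun q => y < q)
  | try_sep memE (fun p => p <= x) (fun q => q <= y)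
  | try_sep memE (fun p => p <= x) (fun q => q < y)
  | try_sep memE (fun p => p < x) (fun q => q <= y)
  | try_sep memE (fun p => p < x) (fun q => q < y) ].
Qed.

Lemma Z_dim_separable (K : fieldType) b k i :
  separable (region b k) (fun p q => (invariant_dim (Z_complex K k p q) i : nat)%:Z).
Proof.
have [bi|] := boolP (is_bidegree_invariant i).
  have [u [w h]] := path_dim_separable b k bi.
  by exists u, w => p q hpq; rewrite path_invariant_dim // h.
case: i => // [n|r x y|r x y] _.
- by apply: (separable_l (u := fun=> (n == k : nat)%:Z)) => p q _; rewrite Z_betti_dim.
- apply: (separable_l (u := fun p => ((x == p) && (y == k - p) : nat)%:Z)) => p q _.
  by rewrite Z_froelicher_dim.
- exists (fun=> 0), (fun q => ((y == q) && (x == k - q) : nat)%:Z) => p q _.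
  by rewrite Z_conj_dim add0r.
Qed.

(** * Pairing a separated function with v *)

Lemma sum_fibers_eq0 (T : choiceType) (v g : T -> int) (u : int -> int) :
  finite_set [set x | v x != 0] ->
  (forall c, \sum_(x \in [set x | g x = c]) v x = 0) ->
  \sum_(x <- fset_set [set x | v x != 0]) v x * u (g x) = 0.
Proof.
move=> fin h; set r := enum_fset _; have ur : uniq r := fset_uniq _.
have r0 x : x \notin r -> v x = 0.
  by rewrite in_fset_set // notin_setE => /negP; rewrite negbK => /eqP.
have fib c : \sum_(x <- r | g x == c) v x = 0.
  rewrite -[RHS](h c) fsbig_mkcond (fsum_support ur) => [|x /r0 vx].
    by rewrite big_mkcond; apply: eq_bigr => x _; rewrite /patch; congr (if _ then _ else _);
      apply/eqP/idP; rewrite in_setE.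
  by rewrite /patch vx if_same.
pose C := undup (map g r).
(* Summing over the values c of [g] groups the terms by fibres; [u] is constant on each fibre, whose
   total weight is 0. *)
transitivity (\sum_(x <- r) \sum_(c <- C) if g x == c then v x * u c else 0).
  apply: eq_big_seq => x xr.
  rewrite (bigD1_seq (g x)) ?undup_uniq ?mem_undup ?map_f //= eqxx big1 ?addr0 //.
  by move=> c; rewrite eq_sym => /negbTE ->.
rewrite exchange_big big1 // => c _; rewrite -big_mkcond -mulr_suml fib.
exact: mul0r.
Qed.

Lemma chi_expr_sum (K : fieldType) (T : Type) (r : seq T) (F : T -> uexpr K) i :
  chi_expr (\big[@Uadd K/Uzero K]_(x <- r) F x) i = \sum_(x <- r) chi_expr (F x) i.
Proof. by elim: r => [|x r IH]; rewrite ?big_nil // !big_cons /= -IH. Qed.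

Lemma chi_expr_scale (K : fieldType) n (x : uexpr K) i :
  chi_expr (uscale n x) i = n * chi_expr x i.
Proof.
have it m : chi_expr (iter m (Uadd x) (Uzero K)) i = m%:Z * chi_expr x i.
  elim: m => [|m IH]; first by rewrite mul0r.
  by rewrite iterS intS mulrDl mul1r -IH.
by case: n => m; [exact: it|rewrite NegzE mulNr -it].
Qed.

Theorem mainTheorem6 (R : realType) (k : int) (b : bool) (v : S_region b k -> int)
  (v_fin : finite_set [set x | v x != 0])
  (v_row : forall q : int, \sum_(x \in [set x : S_region b k | (val x).2 = q]) v x = 0)
  (v_col : forall p : int, \sum_(x \in [set x : S_region b k | (val x).1 = p]) v x = 0) :
  chi (Z_sum R[i] v) = 0.
Proof.
rewrite /Z_sum chi_upi; apply: funext => i; rewrite chi_expr_sum.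
have [u [w uw]] := Z_dim_separable R[i] b k i.
under eq_bigr => x _.
  rewrite chi_expr_scale [chi_expr _ _]uw; last exact: (valP x).
  rewrite mulrDr; over.
rewrite big_split /=.
(* The hole is filled once by each projection: the column sums kill the part in [u], the row sums
   the part in [w]. *)
by rewrite !(sum_fibers_eq0 (g := fun x => _)) // addr0.
Qed.
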